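(* Let $W$ be any irreducible finite Weyl group, with irreducible reflection representation $V$, and let $N$ be the number of reflections in $W$. For every irreducible character (simple $\mathbb{Z}_2$-graded module) $\chi^-$ of the spin Weyl group superalgebra $\mathbb{C}W^-$, the spin fake degree $$P_W^-(\chi^-,t)=\sum_{k\ge0}\dim\mathrm{Hom}_{\mathbb{C}W^-}\big(\chi^-,\ \mathcal{B}_W\otimes(S^kV)_W\big)\,t^k$$ is palindromic; more precisely $$P_W^-(\chi^-,t)=t^N\,P_W^-(\chi^-,t^{-1}).$$
   Context: All algebras and modules are finite-dimensional over $\mathbb{C}$. Modules over a superalgebra $A$ are $\mathbb{Z}_2$-graded, simple means no proper nonzero graded submodule, and $\mathrm{Hom}_A(M,N)$ is spanned by all homogeneous (even and odd) linear maps $f$ with $f(am)=(-1)^{|f||a|}af(m)$. Let $W=\langle s_1,\dots,s_n\mid(s_is_j)^{m_{ij}}=1\rangle$ be the Coxeter presentation. $\mathbb{C}W^-$ is generated by $t_1,\dots,t_n$ with relations $(t_it_j)^{m_{ij}}=(-1)^{m_{ij}+1}$ ($m_{ii}=1$), a superalgebra with each $t_i$ odd. $\mathcal{C}l_V$ is the Clifford superalgebra of $V$ with its $W$-invariant nondegenerate symmetric form ($vw+wv=2(v,w)$, elements of $V$ odd), $\beta_i\in\mathcal{C}l_V$ corresponds to the simple root $\alpha_i$ normalized by $\beta_i^2=1$, and $U$ is the unique simple $\mathcal{C}l_V$-module. The basic spin module $\mathcal{B}_W$ is the pullback of $U$ via the homomorphism $\mathbb{C}W^-\to\mathcal{C}l_V$,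 $t_i\mapsto\beta_i$. $(S^*V)_W=\bigoplus_k(S^kV)_W$ is the coinvariant algebra: the quotient of $S^*V$ by the ideal generated by homogeneous $W$-invariants of positive degree. For a $W$-module $M$, $\mathcal{B}_W\otimes M$ is a $\mathbb{C}W^-$-module via $t_i(u\otimes x)=(t_iu)\otimes(s_ix)$. *)

(* Defs.v *)
From HB Require Import structures.
From mathcomp Require Import all_boot all_order all_algebra all_fingroup.
From mathcomp Require Import all_character.
From mathcomp Require Import boolp reals complex mpoly.

Set Implicit Arguments.
Unset Strict Implicit.
Unset Printing Implicit Defensive.

Import Order.TTheory GRing.Theory Num.Theory VectorInternalTheory.
Local Open Scope ring_scope.

Section LinearAlgebra.
Variable F : fieldType.

Lemma span_pred_exists (V : vectType F) (P : V -> Prop) :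
  exists U : {vspace V}, forall W : {vspace V},
    (U <= W)%VS <-> (forall v, P v -> v \in W).
Proof.
pose Q d := `[< exists2 X : seq V, \dim <<X>> = d & forall v, v \in X -> P v >].
have exQ : exists d, Q d.
  by exists 0%N; apply/asboolP; exists [::]; rewrite ?span_nil ?dimv0.
have boundQ d : Q d -> (d <= \dim {:V})%N.
  by move=> /asboolP[X <- _]; apply/dimvS/subvf.
case: (ex_maxnP exQ boundQ) => d /asboolP[X dimX PX] maxd.
exists <<X>>%VS => W; split=> [sXW v Pv | sPW]; last first.
  by apply/span_subvP => v /PX; apply: sPW.
apply: (subvP sXW); have sX : (<<X>> <= <<v :: X>>)%VS.
  by rewrite span_cons addvSr.
suff /eqP -> : <<X>>%VS == <<v :: X>>%VS by rewrite memv_span ?mem_head.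
rewrite eqEdim sX dimX; apply/maxd/asboolP; exists (v :: X) => // w.
by rewrite inE => /predU1P[-> | /PX].
Qed.

(* The linear span of an arbitrary (not necessarily finite) set of vectors. *)
Definition span_pred (V : vectType F) (P : V -> Prop) : {vspace V} :=
  sval (cid (span_pred_exists P)).

Lemma span_predP (V : vectType F) (P : V -> Prop) (W : {vspace V}) :
  (span_pred P <= W)%VS <-> (forall v, P v -> v \in W).
Proof. by rewrite /span_pred; case: cid. Qed.

Lemma mem_span_pred (V : vectType F) (P : V -> Prop) v :
  P v -> v \in span_pred P.
Proof. by have [+ _] := span_predP P (span_pred P); apply. Qed.

(* The quotient V / U is realized on the complement U^C chosen by the library, *)
(* which quotv_pi identifies with V modulo U.                                  *)
Definition quotv (V : vectType F) (U : {vspace V}) : vectType F :=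
  subvs_of (U^C)%VS.

Definition quotv_pi (V : vectType F) (U : {vspace V}) : 'Hom(V, quotv U) :=
  (linfun (@vsproj F V (U^C)%VS) \o (\1 - projv U))%VF.

Definition quotv_map (V : vectType F) (U : {vspace V}) (f : 'End(V)) :
    'End(quotv U) :=
  (quotv_pi U \o f \o linfun (@vsval F V (U^C)%VS))%VF.

Lemma quotv_piE (V : vectType F) (U : {vspace V}) v :
  vsval (quotv_pi U v) = v - projv U v.
Proof. by rewrite !lfun_simp vsprojK ?memv_projC. Qed.

Lemma quotv_piK (V : vectType F) (U : {vspace V}) (x : quotv U) :
  quotv_pi U (vsval x) = x.
Proof.
apply: subvs_inj; rewrite quotv_piE -[RHS]subr0; congr (_ - _).
by apply/eqP; rewrite -memv_ker lker_proj subvsP.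
Qed.

Lemma lker_quotv_pi (V : vectType F) (U : {vspace V}) : lker (quotv_pi U) = U.
Proof.
apply/vspaceP => v; rewrite memv_ker.
have -> : (quotv_pi U v == 0) = (v - projv U v == 0).
  rewrite -quotv_piE; apply/eqP/eqP => [-> | pi0]; first exact: linear0.
  by apply: subvs_inj; rewrite pi0 linear0.
rewrite subr_eq0.
by apply/eqP/idP => [-> | /projv_id->]; rewrite ?memv_proj.
Qed.

Lemma limg_quotv_pi (V : vectType F) (U : {vspace V}) :
  limg (quotv_pi U) = fullv.
Proof.
apply/vspaceP => x; rewrite memvf -[x]quotv_piK.
by rewrite memv_img ?memvf.
Qed.

Lemma quotv_mapE (V : vectType F) (U : {vspace V}) (f : 'End(V)) v :
  (f @: U <= U)%VS -> quotv_map U f (quotv_pi U v) = quotv_pi U (f v).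
Proof.
move=> sfU.
have -> x : quotv_map U f x = quotv_pi U (f (vsval x)).
  rewrite /quotv_map; move: (quotv_pi U) => p.
  by rewrite !comp_lfunE lfunE.
rewrite quotv_piE !linearB /=.
apply/eqP; rewrite -subr_eq0 addrAC subrr sub0r oppr_eq0 -memv_ker.
by rewrite lker_quotv_pi (subvP sfU) // memv_img ?memv_proj.
Qed.

(* The tensor product of U and V, realized on matrices of coordinates. *)
Definition tensv (U V : vectType F) : vectType F :=
  'M[F]_(dim U, dim V).

Definition tens (U V : vectType F) (u : U) (v : V) : tensv U V :=
  (v2r u)^T *m v2r v.

Definition tens_lfun (U U' V V' : vectType F)
    (f : 'Hom(U, U')) (g : 'Hom(V, V')) : 'Hom(tensv U V, tensv U' V') :=
  linfun (fun A : 'M_(_, _) => (f2mx f)^T *m A *m f2mx g : 'M_(_, _)).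

Lemma tens_lfun_mxE (U U' V V' : vectType F)
    (f : 'Hom(U, U')) (g : 'Hom(V, V')) (A : tensv U V) :
  tens_lfun f g A = (f2mx f)^T *m A *m f2mx g.
Proof.
have lin : linear (fun A : tensv U V =>
    (f2mx f)^T *m A *m f2mx g : tensv U' V').
  by move=> a B C; rewrite mulmxDr mulmxDl -scalemxAr -scalemxAl.
pose h := GRing.isSemilinear.Build F _ _ _ _ (GRing.semilinear_linear lin).
pose H : {linear tensv U V -> tensv U' V'} := HB.pack (fun A : tensv U V =>
    (f2mx f)^T *m A *m f2mx g : tensv U' V') h.
exact: (lfunE H A).
Qed.

Lemma v2r_lfun (U V : vectType F) (f : 'Hom(U, V)) u :
  v2r (f u) = v2r u *m f2mx f.
Proof. by rewrite unlock /= r2vK. Qed.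

Lemma f2mx_comp (U V W : vectType F) (f : 'Hom(V, W)) (g : 'Hom(U, V)) :
  f2mx (f \o g)%VF = f2mx g *m f2mx f.
Proof.
apply/row_matrixP => i; rewrite !rowE -[delta_mx 0 i]r2vK.
by rewrite -v2r_lfun mulmxA -!v2r_lfun comp_lfunE.
Qed.

Lemma tens_lfunE (U U' V V' : vectType F)
    (f : 'Hom(U, U')) (g : 'Hom(V, V')) u v :
  tens_lfun f g (tens u v) = tens (f u) (g v).
Proof. by rewrite tens_lfun_mxE /tens !v2r_lfun trmx_mul !mulmxA. Qed.

Lemma tens_lfun_comp (U U' U'' V V' V'' : vectType F)
    (f : 'Hom(U', U'')) (g : 'Hom(V', V''))
    (f' : 'Hom(U, U')) (g' : 'Hom(V, V')) :
  (tens_lfun f g \o tens_lfun f' g')%VF =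
    tens_lfun (f \o f')%VF (g \o g')%VF.
Proof.
apply/lfunP => A; rewrite comp_lfunE !tens_lfun_mxE !f2mx_comp trmx_mul.
by rewrite !mulmxA.
Qed.

Lemma tens_lfun1 (U V : vectType F) :
  tens_lfun (\1 : 'End(U))%VF (\1 : 'End(V))%VF = \1%VF.
Proof.
have f2mx1 (W : vectType F) : f2mx (\1 : 'End(W))%VF = 1%:M.
  apply/row_matrixP => i; rewrite !rowE -[delta_mx 0 i]r2vK.
  by rewrite -v2r_lfun id_lfunE mulmx1.
by apply/lfunP => A; rewrite tens_lfun_mxE !f2mx1 trmx1 mul1mx mulmx1 id_lfunE.
Qed.

Lemma tens_lfunDl (U U' V V' : vectType F)
    (f1 f2 : 'Hom(U, U')) (g : 'Hom(V, V')) :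
  tens_lfun (f1 + f2) g = tens_lfun f1 g + tens_lfun f2 g.
Proof.
have f2mxD : f2mx (f1 + f2) = f2mx f1 + f2mx f2.
  apply/row_matrixP => i; rewrite linearD /= !rowE -[delta_mx 0 i]r2vK.
  by rewrite -!v2r_lfun add_lfunE linearD.
apply/lfunP => A; rewrite add_lfunE !tens_lfun_mxE f2mxD linearD /=.
by rewrite !mulmxDl.
Qed.

End LinearAlgebra.

Section Supermodules.
Variable F : fieldType.

(* A supermodule over the free superalgebra on the set I of odd generators.   *)
(* Supermodules over a superalgebra presented by odd generators and relations *)
(* are those supermodules in which the defining relations hold.               *)
Record supermod (I : Type) := Supermod {
  scarrier :> vectType F;
  sgrade : bool -> {vspace scarrier};
  sgen : I -> 'End(scarrier);
  sgrade_full : (sgrade false + sgrade true = fullv)%VS;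
  sgrade_direct : (sgrade false :&: sgrade true = 0)%VS;
  sgen_odd : forall i b, (sgen i @: sgrade b <= sgrade (~~ b))%VS
}.

Definition simple_supermod I (M : supermod I) : Prop :=
  ({:M} != 0)%VS /\
  forall U : {vspace M},
    (U = (U :&: sgrade M false) + (U :&: sgrade M true))%VS ->
    (forall i, (sgen M i @: U <= U)%VS) ->
    U = 0%VS \/ U = fullv.

Definition is_superhom I (M N : supermod I) (c : bool) (f : 'Hom(M, N)) : Prop :=
  (forall b, (f @: sgrade M b <= sgrade N (c (+) b))%VS) /\
  forall i m, f (sgen M i m) = (-1) ^+ c *: sgen N i (f m).

Definition superHom I (M N : supermod I) : {vspace 'Hom(M, N)} :=
  span_pred (fun f => exists c, is_superhom c f).

(* Pullback along a homomorphism of superalgebras which sends the generator i *)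
(* to the generator h i.                                                      *)
Definition pullback_supermod I J (h : I -> J) (M : supermod J) : supermod I :=
  Supermod (sgrade_full M) (sgrade_direct M) (fun i => sgen_odd M (h i)).

Section Tensor.
Variables (I : Type) (M : supermod I) (V : vectType F) (g : I -> 'End(V)).

Let pi b : 'End(M) := daddv_pi (sgrade M b) (sgrade M (~~ b)).

(* (M \otimes V)_b = M_b \otimes V *)
Definition tens_grade b : {vspace tensv M V} := limg (tens_lfun (pi b) \1%VF).

Let dirM b : (sgrade M b :&: sgrade M (~~ b) = 0)%VS.
Proof. by case: b; rewrite /= ?sgrade_direct // capvC sgrade_direct. Qed.

Let pi_id b x : x \in sgrade M b -> pi b x = x.
Proof. exact/daddv_pi_id/dirM. Qed.

Let pi_idem b : (pi b \o pi b = pi b)%VF.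
Proof. by apply/lfunP => x; rewrite comp_lfunE pi_id ?memv_pi. Qed.

Let pi_sum : pi false + pi true = \1%VF.
Proof.
apply/lfunP => x; rewrite add_lfunE id_lfunE /pi daddv_pi_add ?sgrade_direct //.
by rewrite sgrade_full memvf.
Qed.

Let pi_orth : (pi false \o pi true = 0)%VF.
Proof.
apply/eqP; rewrite -(inj_eq (addIr (pi true \o pi true)%VF)) -comp_lfunDl.
by rewrite pi_sum comp_lfun1l add0r pi_idem.
Qed.

Lemma tens_grade_full : (tens_grade false + tens_grade true = fullv)%VS.
Proof.
apply/vspaceP => x; rewrite memvf -[x](id_lfunE x) -tens_lfun1 -pi_sum.
by rewrite tens_lfunDl add_lfunE memv_add ?memv_img ?memvf.
Qed.

Lemma tens_grade_direct : (tens_grade false :&: tens_grade true = 0)%VS.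
Proof.
apply/eqP; rewrite -subv0; apply/subvP => x /memv_capP[].
case/memv_imgP => y _ defx /memv_imgP[z _ xz]; rewrite memv0.
have: tens_lfun (pi false) \1%VF x = x.
  by rewrite defx -comp_lfunE tens_lfun_comp pi_idem comp_lfun1l.
rewrite {1}xz -comp_lfunE tens_lfun_comp pi_orth => <-.
have -> : tens_lfun (0 : 'End(M)) (\1 \o \1 : 'End(V))%VF = 0.
  apply: (addrI (tens_lfun 0 (\1 \o \1)%VF)).
  by rewrite -tens_lfunDl !addr0.
by rewrite zero_lfunE.
Qed.

Lemma tens_gen_odd i b :
  (tens_lfun (sgen M i) (g i) @: tens_grade b <= tens_grade (~~ b))%VS.
Proof.
apply/subvP => _ /memv_imgP[_ /memv_imgP[x _ ->] ->].
have -> : tens_lfun (sgen M i) (g i) (tens_lfun (pi b) \1%VF x) =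
  tens_lfun (pi (~~ b)) \1%VF (tens_lfun (sgen M i \o pi b)%VF (g i) x).
  rewrite -!comp_lfunE !tens_lfun_comp comp_lfun1r comp_lfun1l.
  congr (tens_lfun _ _ _); apply/lfunP => y; rewrite !comp_lfunE [RHS]pi_id //.
  by rewrite (subvP (sgen_odd M i b)) // memv_img ?memv_pi.
by rewrite memv_img ?memvf.
Qed.

(* The generator i acts by u \otimes x |-> (i u) \otimes (g i x). *)
Definition tens_supermod : supermod I :=
  Supermod tens_grade_full tens_grade_direct tens_gen_odd.

End Tensor.

End Supermodules.

Section SymmetricAlgebra.
Variables (F : fieldType) (n : nat).

(* The variables 'X_i of {mpoly F[n]} stand for the standard basis of the     *)
(* space V of row vectors, so that {mpoly F[n]} is S^*V and dhomog n F k is   *)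
(* S^kV; sym_act A is the algebra endomorphism extending v |-> v *m A.        *)
Definition sym_act (A : 'M[F]_n) (p : {mpoly F[n]}) : {mpoly F[n]} :=
  p \mPo [tuple \sum_j A i j *: 'X_j | i < n].

Lemma sym_act_homog (A : 'M[F]_n) k (p : {mpoly F[n]}) :
  p \is k.-homog -> sym_act A p \is k.-homog.
Proof.
move=> /dhomogP hp; rewrite /sym_act comp_mpolyEX big_seq rpred_sum // => m mp.
rewrite rpredZ // comp_mpolyX -(hp m mp) /= mdegE.
elim/big_ind2: _ => [|p1 d1 p2 d2|i _]; [exact: dhomog1 | exact: dhomogM |].
suff /(dhomogMn (m i)) : tnth [tuple \sum_j A i j *: 'X_j | i < n] i
    \is 1.-homog by rewrite mul1n.
rewrite tnth_mktuple rpred_sum // => j _; rewrite rpredZ //.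
by rewrite dhomogX /= mdeg1.
Qed.

End SymmetricAlgebra.

Section SymmetricPower.
Variables (F : fieldType) (n : nat).

Definition sym_power (A : 'M[F]_n.+1) k : 'End(dhomog n.+1 F k) :=
  linfun (fun p => DHomog (sym_act_homog A (dhomog_is_dhomog p))).

Lemma sym_powerE A k (p : dhomog n.+1 F k) :
  mpoly_of_dhomog (sym_power A k p) = sym_act A p.
Proof.
pose f p : dhomog n.+1 F k := DHomog (sym_act_homog A (dhomog_is_dhomog p)).
have lin : linear f.
  by move=> a q r; apply: val_inj; rewrite /= /sym_act linearP.
pose h := GRing.isSemilinear.Build F _ _ _ _ (GRing.semilinear_linear lin).
pose H : {linear dhomog n.+1 F k -> dhomog n.+1 F k} := HB.pack f h.
by rewrite /sym_power (lfunE H).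
Qed.

End SymmetricPower.

Section RootSystems.

Definition dot (F : fieldType) n (G : 'M[F]_n) (x y : 'rV[F]_n) : F :=
  (x *m G *m y^T) 0 0.

Variables (R : realType) (n : nat).
Implicit Types (G : 'M[R]_n) (Phi : seq 'rV[R]_n) (alpha : 'I_n -> 'rV[R]_n).

Definition inner_product G : Prop :=
  G^T = G /\ forall x, x != 0 -> 0 < dot G x x.

Definition reflection G (a x : 'rV[R]_n) : 'rV[R]_n :=
  x - (2 * dot G x a / dot G a a) *: a.

(* Reduced crystallographic root systems in the Euclidean space of Gram       *)
(* matrix G.                                                                  *)
Record root_system G Phi : Prop := {
  roots_span : <<Phi>>%VS = fullv;
  roots_neq0 : 0 \notin Phi;
  roots_reflection : {in Phi &, forall a b, reflection G a b \in Phi};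
  roots_integral :
    {in Phi &, forall a b, 2 * dot G b a / dot G a a \is a Num.int};
  roots_reduced :
    forall a (c : R), a \in Phi -> c *: a \in Phi -> c = 1 \/ c = -1
}.

Definition simple_system Phi alpha : Prop :=
  [/\ forall i, alpha i \in Phi,
      free [seq alpha i | i <- enum 'I_n] &
      forall b, b \in Phi -> exists c : 'I_n -> nat,
        b = \sum_i (c i)%:R *: alpha i \/ b = - \sum_i (c i)%:R *: alpha i].

Definition irreducible_root_system G Phi : Prop :=
  Phi != [::] /\
  forall S : pred 'rV[R]_n,
    {in Phi &, forall a b, S a -> ~~ S b -> dot G a b = 0} ->
    {in Phi, forall a, S a} \/ {in Phi, forall a, ~~ S a}.

End RootSystems.

(* A Weyl group of rank n, with a choice of simple roots: a finite group      *)
(* generated by elements s_i, with a faithful representation on V = R^n in    *)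
(* which s_i is the reflection in the i-th simple root. Representations in    *)
(* the library act on row vectors, from the right; since only the action of   *)
(* the involutions s_i and W-invariance are used, this makes no difference.   *)
Record weyl_group (R : realType) (n : nat) := WeylGroup {
  wgram : 'M[R]_n;
  wroots : seq 'rV[R]_n;
  wsimple : 'I_n -> 'rV[R]_n;
  wtype : finGroupType;
  wgroup : {group wtype};
  wrefl : 'I_n -> wtype;
  wrepr : mx_representation R wgroup n;
  wgramP : inner_product wgram;
  wrootsP : root_system wgram wroots;
  wsimpleP : simple_system wroots wsimple;
  wgroup_gen : (<<[set wrefl i | i : 'I_n]>> = wgroup)%g;
  wrepr_faithful : mx_faithful wrepr;
  wreflE : forall i x, x *m wrepr (wrefl i) = reflection wgram (wsimple i) x
}.

Section WeylGroups.
Variables (R : realType) (n : nat) (W : weyl_group R n).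
Let C : fieldType := R[i].

(* The exponents m_ij of the Coxeter presentation are the orders of s_i s_j.   *)
Definition coxeter_exponent (i j : 'I_n) : nat :=
  #[wrefl W i * wrefl W j]%g.

(* The elements of W that fix a hyperplane of V pointwise. *)
Definition reflections : {set wtype W} :=
  [set w in wgroup W | \rank (wrepr W w - 1%:M) == 1%N].

Definition complex_repr (w : wtype W) : 'M[C]_n :=
  map_mx (real_complex R) (wrepr W w).

(* The Clifford superalgebra is generated by the odd vectors of the complex   *)
(* space V; the first condition states the linearity of V -> Cl_V.            *)
Definition clifford_module (U : supermod C 'rV[C]_n) : Prop :=
  (forall a v w, sgen U (a *: v + w) = a *: sgen U v + sgen U w) /\
  (forall v w x, sgen U v (sgen U w x) + sgen U w (sgen U v x) =
     (2 * dot (map_mx (real_complex R) (wgram W)) v w) *: x).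

(* beta_i is a positive multiple of the simple root alpha_i: the signs cannot *)
(* be chosen independently if t_i |-> beta_i is to define a homomorphism.     *)
Definition beta (i : 'I_n) : 'rV[C]_n :=
  map_mx (real_complex R)
    ((Num.sqrt (dot (wgram W) (wsimple W i) (wsimple W i)))^-1 *: wsimple W i).

(* (t_i t_j)^m_ij = (-1)^(m_ij + 1), for t_i the i-th generator. *)
Definition spin_module (M : supermod C 'I_n) : Prop :=
  forall i j x,
    iter (coxeter_exponent i j) (fun y => sgen M i (sgen M j y)) x =
    (-1) ^+ (coxeter_exponent i j).+1 *: x.

Definition basic_spin (U : supermod C 'rV[C]_n) : supermod C 'I_n :=
  pullback_supermod beta U.

Definition invariant (p : {mpoly C[n]}) : Prop :=
  forall w, w \in wgroup W -> sym_act (complex_repr w) p = p.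

Definition coinvariant_ideal (p : {mpoly C[n]}) : Prop :=
  exists r : seq ({mpoly C[n]} * {mpoly C[n]}),
    (forall gh, gh \in r -> invariant gh.2 /\
       exists2 d, (0 < d)%N & gh.2 \is d.-homog) /\
    p = \sum_(gh <- r) gh.1 * gh.2.

End WeylGroups.

Section SpinFakeDegree.
Variables (R : realType) (n : nat) (W : weyl_group R n.+1).
Let C : fieldType := R[i].

Definition coinvariant_relations k : {vspace dhomog n.+1 C k} :=
  span_pred (fun p : dhomog n.+1 C k => coinvariant_ideal W p).

(* The degree k component of (S^*V)_W: S^kV modulo its intersection with the  *)
(* coinvariant ideal.                                                         *)
Definition coinvariants k : vectType C := quotv (coinvariant_relations k).

Definition coinvariant_act k (i : 'I_n.+1) : 'End(coinvariants k) :=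
  quotv_map (coinvariant_relations k)
    (sym_power (complex_repr (wrefl W i)) k).

Lemma coinvariant_actE k i (p : dhomog n.+1 C k) :
  coinvariant_act k i (quotv_pi (coinvariant_relations k) p) =
  quotv_pi _ (sym_power (complex_repr (wrefl W i)) k p).
Proof.
apply: quotv_mapE; set s := sym_power _ _; set U := coinvariant_relations k.
have sU : (U <= s @^-1: U)%VS.
  apply/span_predP => q [r [rinv q_r]]; rewrite -memv_preim.
  apply: mem_span_pred; rewrite sym_powerE q_r.
  pose A := complex_repr (wrefl W i).
  exists [seq (sym_act A gh.1, gh.2) | gh <- r]; split.
    by move=> _ /mapP[gh /rinv ? ->].
  rewrite big_map /sym_act raddf_sum /= big_seq [RHS]big_seq.
  apply: eq_bigr => gh /rinv[inv _]; rewrite rmorphM /=; congr (_ * _).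
  by apply: inv; rewrite -(wgroup_gen W) mem_gen ?imset_f.
by apply/subvP => _ /memv_imgP[q /(subvP sU) Uq ->]; rewrite memv_preim.
Qed.

Definition spin_fake_coef (U : supermod C 'rV[C]_n.+1)
    (chi : supermod C 'I_n.+1) (k : nat) : nat :=
  \dim (superHom chi (tens_supermod (basic_spin W U) (coinvariant_act k))).

(* P = \sum_(k >= 0) dim Hom (...) t^k, the sum being finite. *)
Definition is_spin_fake_degree (U : supermod C 'rV[C]_n.+1)
    (chi : supermod C 'I_n.+1) (P : {poly C}) : Prop :=
  forall k, P`_k = (spin_fake_coef U chi k)%:R.

End SpinFakeDegree.

(* Main.v *)
Require Import Defs.
From HB Require Import structures.
From mathcomp Require Import all_boot all_order all_algebra all_fingroup.
From mathcomp Require Import all_character.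
From mathcomp Require Import boolp reals complex mpoly.

Set Implicit Arguments.
Unset Strict Implicit.
Unset Printing Implicit Defensive.

Import Order.TTheory GRing.Theory Num.Theory.
Local Open Scope ring_scope.

(** The spin structure enters only through one remark: on a supermodule whose
    generators act by odd operators, the grading involution changes the sign of
    every generator. So for a basic spin module B and W-modules M and M', a
    linear injection theta : M -> M' with theta (s_i x) = - s_i (theta x) gives,
    by tensoring with the grading involution of B, an injective even morphism
    from the tensor product of B and M to that of B and M', hence an inequality
    between the multiplicities of any chi ([superHom_parity_twist]). It remains
    to inject the degree d coinvariants into the degree N - d coinvariants by
    such a map, for every d <= N, and to kill the coinvariants of degree > N:
    the inequalities for d and for N - d then give the symmetry.

    This is Poincare duality for the coinvariant algebra S/I. Let Delta be the
    product of one linear form alpha_t for each reflection t, of degree N. A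
    skew polynomial is divisible by Delta ([skew_root_product_dvd]), because it
    vanishes on each reflecting hyperplane and the forms alpha_t are pairwise
    non-proportional. Let Alt be the antisymmetrization operator, and pair p and q
    of complementary degrees by the coefficient of Delta in Alt (p q). This
    pairing vanishes on I and its radical is exactly I
    ([coinvariant_pairing_nondeg]). The latter goes by downward induction on the
    degree of p, started by the finite dimension of S/I: if p is in the radical,
    so is alpha_t p, which therefore lies in I; applying 1 - t and dividing by
    alpha_t gives p + t p in I, for every reflection t. As W is generated by
    reflections, p is congruent modulo I to Alt p up to the factor |W|, and
    Alt p is Delta times an invariant, which is in I when deg p > N, is zero when
    deg p < N, and vanishes by hypothesis when deg p = N.

    The pairing identifies a graded piece of S/I with the sign twist of the dual
    of the complementary piece. The dual is removed by a W-invariant symmetric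
    bilinear form on S^e, the average of the standard one. W acts by real
    matrices, so the form is anisotropic along complex conjugation, p and its
    conjugate pairing to zero only for p = 0; since I is stable under conjugation,
    it meets its orthogonal in zero, and the orthogonal of I_e, which represents
    the dual of S^e/I_e, embeds in S^e/I_e ([dual_hom_ideal_inv]). *)

(** * Linear substitutions in polynomial rings *)

HB.instance Definition _ (F : fieldType) n (A : 'M[F]_n) :=
  GRing.LRMorphism.copy (@sym_act F n A)
    (comp_mpoly [tuple \sum_j A i j *: 'X_j | i < n]).

Section SymAct.
Variables (F : fieldType) (n : nat).
Implicit Types (A B : 'M[F]_n) (p q : {mpoly F[n]}) (v : 'rV[F]_n).

Definition linform v : {mpoly F[n]} := \sum_j v 0 j *: 'X_j.

Lemma linform_coef v j : (linform v)@_U_(j) = v 0 j.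
Proof.
rewrite raddf_sum (bigD1 j) //= big1 => [|i /negbTE ij].
  by rewrite mcoeffZ mcoeffXU eqxx mulr1 addr0.
by rewrite mcoeffZ mcoeffXU ij mulr0.
Qed.

Lemma linform_eq0 v : (linform v == 0) = (v == 0).
Proof.
apply/eqP/eqP=> [v0 | ->]; last first.
  by rewrite /linform big1 // => j _; rewrite mxE scale0r.
by apply/rowP => j; rewrite -linform_coef v0 mcoeff0 mxE.
Qed.

Lemma linform_homog v : linform v \is 1.-homog.
Proof. by rewrite rpred_sum // => j _; rewrite rpredZ // dhomogX /= mdeg1. Qed.

Lemma linformZ a v : linform (a *: v) = a *: linform v.
Proof.
by rewrite /linform scaler_sumr; apply: eq_bigr => j _; rewrite mxE scalerA.
Qed.

Lemma sym_actX A i : sym_act A 'X_i = linform (row i A).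
Proof.
rewrite /sym_act comp_mpolyXU -tnth_nth tnth_mktuple.
by apply: eq_bigr => j _; rewrite mxE.
Qed.

Lemma sym_act_linform A v : sym_act A (linform v) = linform (v *m A).
Proof.
rewrite linear_sum /=.
have E i : sym_act A (v 0 i *: 'X_i) = \sum_j (v 0 i * A i j) *: 'X_j.
  rewrite linearZ /= sym_actX scaler_sumr.
  by apply: eq_bigr => j _; rewrite mxE scalerA.
rewrite (eq_bigr _ (fun i _ => E i)).
rewrite exchange_big /=; apply: eq_bigr => j _.
by rewrite -scaler_suml mxE.
Qed.

(** Enough to compare two ring morphisms that agree on scalars and variables, or
    to prove a property stable under sums and products. *)
Lemma mpoly_alg_ind (P : {mpoly F[n]} -> Prop) :
  (forall c, P c%:MP) -> (forall i, P 'X_i) ->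
  (forall p q, P p -> P q -> P (p + q)) ->
  (forall p q, P p -> P q -> P (p * q)) -> forall p, P p.
Proof.
move=> PC PX PD PM; apply: mpolyind => [|c m p _ _ Pp]; first by rewrite -mpolyC0.
apply: PD => //; rewrite -mul_mpolyC; apply: (PM) => //.
have P1 : P 1 by rewrite -mpolyC1; apply: PC.
rewrite mpolyXE_id; apply: (@big_ind _ P 1 *%R) => // i _.
by elim: (m i) => [|k IH]; rewrite ?expr0 // exprS; apply: PM.
Qed.

(** The order is reversed because matrices act on row vectors from the right. *)
Lemma sym_actM A B p : sym_act A (sym_act B p) = sym_act (B *m A) p.
Proof.
elim/mpoly_alg_ind: p => [c|i|p q Pp Pq|p q Pp Pq].
- by rewrite /sym_act !comp_mpolyC.
- rewrite !sym_actX sym_act_linform; congr linform.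
  by rewrite row_mul.
- by rewrite !raddfD /= Pp Pq.
- by rewrite !rmorphM /= Pp Pq.
Qed.

Lemma sym_act1 p : sym_act 1%:M p = p.
Proof.
elim/mpoly_alg_ind: p => [c|i|p q Pp Pq|p q Pp Pq].
- by rewrite /sym_act !comp_mpolyC.
- rewrite sym_actX /linform (bigD1 i) //= big1 => [|j /negbTE ji].
    by rewrite !mxE eqxx scale1r addr0.
  by rewrite !mxE eq_sym ji scale0r.
- by rewrite !raddfD /= Pp Pq.
- by rewrite !rmorphM /= Pp Pq.
Qed.

(** A substitution that moves vectors only along the line of a induces the
    identity modulo the form of a. Both uses are for a reflection and for the
    projection onto its hyperplane. *)
Lemma sym_act_sub_dvd A a p : (A - 1%:M <= a)%MS ->
  exists q, sym_act A p - p = linform a * q.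
Proof.
move=> sAa; elim/mpoly_alg_ind: p => [c|i|p q [p' Pp] [q' Pq]|p q [p' Pp] [q' Pq]].
- by exists 0; rewrite /sym_act comp_mpolyC subrr mulr0.
- have /sub_rVP[c ec] : (row i (A - 1%:M) <= a)%MS.
    by rewrite (submx_trans _ sAa) ?row_sub.
  exists c%:MP; rewrite -{2}['X_i]sym_act1 !sym_actX mulrC mul_mpolyC -linformZ.
  rewrite -ec /linform -sumrB; apply: eq_bigr => j _.
  by rewrite !mxE scalerBl.
- by exists (p' + q'); rewrite raddfD /= opprD addrACA Pp Pq mulrDr.
- exists (sym_act A p * q' + p' * q).
  (* f(pq) - pq = f(p) (f(q) - q) + (f(p) - p) q *)
  rewrite rmorphM /= mulrDr mulrCA -Pq mulrA -Pp mulrBr mulrBl.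
  by rewrite addrA subrK.
Qed.

End SymAct.

Lemma map_sym_act (F F' : fieldType) (f : {rmorphism F -> F'}) n (A : 'M[F]_n) p :
  map_mpoly f (sym_act A p) = sym_act (map_mx f A) (map_mpoly f p).
Proof.
elim/mpoly_alg_ind: p => [c|i|p q Pp Pq|p q Pp Pq].
- by rewrite map_mpolyC /sym_act !comp_mpolyC map_mpolyC.
- rewrite map_mpolyX !sym_actX /linform raddf_sum /=.
  by apply: eq_bigr => j _; rewrite map_mpolyZ map_mpolyX !mxE.
- by rewrite !raddfD /= Pp Pq.
- by rewrite !rmorphM /= Pp Pq.
Qed.

(** * Homogeneous polynomials *)

Section Homogeneous.
Variables (F : fieldType) (n : nat).

(** The component of degree j of q contributes the component of degree N + j of
    p q, which vanishes unless N + j = d. *)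
Lemma dhomog_divl (p q : {mpoly F[n]}) N d :
  p != 0 -> p \is N.-homog -> p * q \is d.-homog ->
  q \is (d - N).-homog /\ ((d < N)%N -> q = 0).
Proof.
move=> p0 hp hpq.
have [k qE] : exists k, q = \sum_(j < k) pihomog mdeg j q.
  by exists (msize q); rewrite -pihomog_partitionE.
have q0 (j : 'I_k) : (N + j)%N != d -> pihomog mdeg j q = 0.
  rewrite eq_sym => Njd; apply: (mulfI p0); rewrite mulr0.
  rewrite -(pihomog_ne0 (mf := mdeg) Njd hpq) [in RHS]qE [in RHS]mulr_sumr linear_sum /=.
  have hp_j i : p * pihomog mdeg i q \is (N + i).-homog.
    by apply: dhomogM hp _; apply: pihomogP.
  rewrite (bigD1 j) //= (pihomog_dE (hp_j j)) big1 ?addr0 // => i /eqP ij.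
  apply: (@pihomog_ne0 _ _ mdeg (N + i)) => //.
  by rewrite eqn_add2l; apply/eqP => /val_inj.
split=> [|dN]; last first.
  rewrite qE big1 // => j _; apply: q0.
  by rewrite neq_ltn (leq_trans dN) ?orbT ?leq_addr.
rewrite qE rpred_sum // => j _; have [Njd|/q0->] := eqVneq (N + j)%N d.
  by rewrite -Njd addKn pihomogP.
exact: dhomog0.
Qed.

Lemma homog_coef_prodXsubC (s : seq {mpoly F[n]}) k :
  all (fun a => a \is 1.-homog) s -> (k <= size s)%N ->
  (\prod_(a <- s) ('X - a%:P))`_k \is (size s - k).-homog.
Proof.
elim: s k => [|a s IH] k /=.
  by rewrite leqn0 big_nil => _ /eqP ->; rewrite coef1 dhomog1.
case/andP=> ha hs k_le; rewrite big_cons mulrBl coefB coefXM coefCM.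
apply: rpredB.
  case: k k_le => [|k] /= k_le; first exact: dhomog0.
  by rewrite subSS IH.
have [k_s|k_s] := leqP k (size s).
  by rewrite subSn //; apply: (dhomogM ha (IH _ hs k_s)).
rewrite nth_default ?mulr0 ?dhomog0 // size_prod_XsubC //.
Qed.

End Homogeneous.

(** * Real matrices of finite order *)

Lemma rank1_nz_row (F : fieldType) m k (A : 'M[F]_(m, k)) :
  \rank A = 1%N -> (nz_row A == A)%MS.
Proof.
move=> rA; have nzA : nz_row A != 0.
  by rewrite nz_row_eq0 -mxrank_eq0 rA.
by rewrite nz_row_sub -(geq_leqif (mxrank_leqif_sup (nz_row_sub A))) rA rank_rV nzA.
Qed.

Section FiniteOrderMatrices.
Variables (F : realFieldType) (n : nat).
Implicit Types (A B : 'M[F]_n.+1) (a : 'rV[F]_n.+1).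

(** In characteristic zero, (1 + N)^m = 1 + m N when N^2 = 0. *)
Lemma unipotent_finite_order A m : (0 < m)%N ->
  (A - 1) * (A - 1) = 0 -> A ^+ m = 1 -> A = 1.
Proof.
move=> m_gt0 N2 Am; set N := A - 1 in N2.
have AN : A = 1 + N by rewrite addrC subrK.
have E k : A ^+ k = 1 + N *+ k.
  elim: k => [|k IH]; first by rewrite expr0 mulr0n addr0.
  rewrite exprS IH {1}AN mulrDl mul1r mulrDr mulr1.
  by rewrite mulrnAr N2 mul0rn addr0 mulrS -addrA [_ + N]addrC.
have /eqP: N *+ m = 0 by apply: (addrI 1); rewrite -E Am addr0.
rewrite -scaler_nat scaler_eq0 pnatr_eq0 -[m == 0]negbK -lt0n m_gt0 /= => /eqP N0.
by rewrite AN N0 addr0.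
Qed.

(** The row a is an eigenvector, with an eigenvalue that is a real root of unity:
    1 or -1. The value 1 would make A unipotent, hence trivial. *)
Lemma rank1_finite_order A a m : (0 < m)%N -> A ^+ m = 1 ->
  a != 0 -> A != 1 -> (A - 1%:M <= a)%MS -> a *m A = - a.
Proof.
move=> m_gt0 Am a0 A1 /submxP[u Au].
pose c := (a *m u) 0 0.
have auE : a *m u = c%:M by rewrite -mx11_scalar.
have aA : a *m A = (1 + c) *: a.
  have -> : A = 1%:M + u *m a by rewrite -Au addrC subrK.
  by rewrite mulmxDr mulmx1 mulmxA auE mul_scalar_mx scalerDl scale1r.
have aAk k : a *m A ^+ k = (1 + c) ^+ k *: a.
  elim: k => [|k IH]; first by rewrite !expr0 mulmx1 scale1r.
  by rewrite exprS mulmxA aA -scalemxAl IH scalerA -exprS.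
have c1 : (1 + c) ^+ m = 1.
  apply/eqP; rewrite -subr_eq0; have /eqP := aAk m.
  by rewrite Am mulmx1 -subr_eq0 -{1}[a]scale1r -scalerBl scaler_eq0 (negPf a0)
    orbF -oppr_eq0 opprB.
have : `|1 + c| == 1 by rewrite -(@pexpr_eq1 _ _ m) // -normrX c1 normr1.
rewrite eqr_norml ler01 andbT => /orP[|] /eqP c2; last first.
  by rewrite aA c2 scaleN1r.
have c0 : c = 0 by apply: (addrI 1); rewrite c2 addr0.
case/negP: A1; apply/eqP/(unipotent_finite_order m_gt0) => //.
rewrite -[_ * _]/(_ *m _) -[1]/(1%:M) Au -mulmxA (mulmxA a) auE c0.
by rewrite mul_scalar_mx scale0r mulmx0.
Qed.

Lemma neg_rank1_sqr A a : (A - 1%:M <= a)%MS -> a *m A = - a -> A * A = 1.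
Proof.
case/submxP=> u Au aA; apply/eqP; rewrite -subr_eq0.
have -> : A * A - 1 = (A - 1%:M) *m A + (A - 1%:M).
  by rewrite mulmxBl mul1mx addrA subrK.
by rewrite Au -mulmxA aA mulmxN addNr.
Qed.

(** A B fixes a and moves vectors along a, so it is unipotent, hence trivial; and
    B is an involution. *)
Lemma rank1_finite_order_uniq A B a m : (0 < m)%N -> (A * B) ^+ m = 1 ->
  (A - 1%:M <= a)%MS -> a *m A = - a -> (B - 1%:M <= a)%MS -> a *m B = - a ->
  A = B.
Proof.
move=> m_gt0 ABm sA aA sB aB.
have AB1 : A * B = 1.
  apply: (unipotent_finite_order m_gt0 _ ABm).
  have /submxP[u uE] : (A * B - 1 <= a)%MS.
    have -> : A * B - 1 = (A - 1%:M) *m B + (B - 1%:M).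
      by rewrite mulmxBl mul1mx addrA subrK.
    rewrite addmx_sub // (submx_trans (submxMr B sA)) // aB.
    by rewrite -scaleN1r scalemx_sub.
  rewrite -[_ * _]/(_ *m _) {1}uE -mulmxA mulmxBr mulmx1 [_ *m (_ * _)]mulmxA.
  by rewrite aA mulNmx aB opprK subrr mulmx0.
by rewrite -[A]mulr1 -(neg_rank1_sqr sB aB) mulrA AB1 mul1r.
Qed.

End FiniteOrderMatrices.

(** * Reflections and their root forms *)

Section Reflections.
Variables (R : realType) (n : nat) (W : weyl_group R n.+1).
Local Notation C := (R[i] : fieldType).
Local Notation G := (wgroup W).
Local Notation rG := (wrepr W).

Lemma complex_repr1 : complex_repr (1%g : wtype W) = 1%:M.
Proof. exact: (repr_mx1 (map_repr (real_complex R) rG)). Qed.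

Lemma complex_reprM : {in G &, forall v w,
  complex_repr (v * w)%g = complex_repr v *m complex_repr w}.
Proof. exact: (repr_mxM (map_repr (real_complex R) rG)). Qed.

Lemma refl_group t : t \in reflections W -> t \in G.
Proof. by rewrite inE => /andP[]. Qed.

Lemma wrefl_group i : wrefl W i \in G.
Proof. by rewrite -(wgroup_gen W) mem_gen ?imset_f. Qed.

(** A generator of the line of t - 1; for a simple reflection it is a multiple
    of the simple root. *)
Definition real_root (t : wtype W) : 'rV[R]_n.+1 := nz_row (rG t - 1%:M).

Lemma real_root_eqmx t : t \in reflections W -> (real_root t :=: rG t - 1%:M)%MS.
Proof. by rewrite inE => /andP[_ /eqP rt]; apply/eqmxP/rank1_nz_row. Qed.

Lemma real_root_neq0 t : t \in reflections W -> real_root t != 0.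
Proof.
by rewrite inE nz_row_eq0 => /andP[_ /eqP rt]; rewrite -mxrank_eq0 rt.
Qed.

Lemma wrepr_order t : t \in G -> rG t ^+ #[t]%g = 1.
Proof. by move=> Gt; rewrite -repr_mxX // expg_order repr_mx1. Qed.

Lemma real_root_refl t : t \in reflections W ->
  real_root t *m rG t = - real_root t.
Proof.
move=> rt; have Gt := refl_group rt.
apply: (@rank1_finite_order _ _ _ _ #[t]%g) (real_root_neq0 rt) _ _ => //.
- exact: wrepr_order.
- apply: contraTneq rt => /= rt1.
  by rewrite inE rt1 subrr mxrank0 andbF.
- by rewrite real_root_eqmx.
Qed.

(** A reflection is determined by its line alone, by finiteness of the order of
    the product of two reflections with the same line. *)
Lemma real_root_inj s t : s \in reflections W -> t \in reflections W ->
  (real_root s <= real_root t)%MS -> s = t.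
Proof.
move=> rs rt s_t; have [Gs Gt] := (refl_group rs, refl_group rt).
apply: (mx_faithful_inj (wrepr_faithful W) Gs Gt).
apply: (@rank1_finite_order_uniq _ _ _ _ (real_root t) #[s * t]%g) => //.
- by rewrite -[_ * _]/(_ *m _) -repr_mxM // wrepr_order ?groupM.
- by rewrite -(real_root_eqmx rs).
- have t_s : (real_root t <= real_root s)%MS.
    rewrite -(geq_leqif (mxrank_leqif_sup s_t)).
    by rewrite !rank_rV !real_root_neq0.
  case/sub_rVP: t_s => c ->.
  by rewrite -scalemxAl real_root_refl // scalerN.
- by rewrite real_root_eqmx.
- exact: real_root_refl.
Qed.

Lemma refl_conj_sub1 t v : t \in G -> v \in G ->
  rG (t ^ v)%g - 1%:M = rG v^-1%g *m (rG t - 1%:M) *m rG v.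
Proof.
move=> Gt Gv; rewrite /conjg !repr_mxM ?groupM ?groupV // mulmxBr mulmxBl mulmx1.
by rewrite mulmxA; congr (_ - _); rewrite -repr_mxM ?groupV // mulVg repr_mx1.
Qed.

Lemma refl_conj t v : t \in reflections W -> v \in G ->
  (t ^ v)%g \in reflections W.
Proof.
move=> rt Gv; have Gt := refl_group rt.
rewrite inE groupJ //=; move: rt; rewrite inE Gt /= => /eqP <-.
rewrite -/rG refl_conj_sub1 // mxrankMfree ?row_free_unit ?repr_mx_unit //.
by rewrite eqmxMfull // row_full_unit repr_mx_unit ?groupV.
Qed.

Lemma real_root_conj t v : t \in reflections W -> v \in G ->
  exists c, real_root t *m rG v = c *: real_root (t ^ v)%g.
Proof.
move=> rt Gv; have Gt := refl_group rt; apply/sub_rVP.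
rewrite (real_root_eqmx (refl_conj rt Gv)) refl_conj_sub1 //.
rewrite submxMr // eqmxMfull ?real_root_eqmx //.
by rewrite row_full_unit repr_mx_unit ?groupV.
Qed.

Definition root_form (t : wtype W) : {mpoly C[n.+1]} :=
  linform (map_mx (real_complex R) (real_root t)).

Definition wact (w : wtype W) : {mpoly C[n.+1]} -> {mpoly C[n.+1]} :=
  sym_act (complex_repr w).

HB.instance Definition _ w :=
  GRing.LRMorphism.copy (wact w) (sym_act (complex_repr w)).

Lemma wact1 p : wact 1%g p = p.
Proof. by rewrite /wact complex_repr1 sym_act1. Qed.

Lemma wactM v w p : v \in G -> w \in G -> wact (v * w)%g p = wact w (wact v p).
Proof. by move=> Gv Gw; rewrite /wact sym_actM -(complex_reprM Gv Gw). Qed.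

Lemma wactZ w c p : wact w (c *: p) = c *: wact w p.
Proof. exact: linearZ. Qed.

Lemma wactB w p q : wact w (p - q) = wact w p - wact w q.
Proof. exact: linearB. Qed.

Lemma wact_homog w d p : p \is d.-homog -> wact w p \is d.-homog.
Proof. exact: sym_act_homog. Qed.

Lemma wact_invariant w p : w \in G -> Defs.invariant W p -> wact w p = p.
Proof. by move=> Gw; apply. Qed.

(** Complex conjugation of coefficients; it commutes with W, whose matrices are
    real. *)
Definition mconj : {mpoly C[n.+1]} -> {mpoly C[n.+1]} := map_mpoly (@conjc R).

HB.instance Definition _ := GRing.RMorphism.copy mconj (map_mpoly (@conjc R)).

Lemma mcoeff_mconj p m : (mconj p)@_m = conjc p@_m.
Proof. exact: mcoeff_map_mpoly. Qed.

Lemma mconj_homog d p : p \is d.-homog -> mconj p \is d.-homog.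
Proof.
move/dhomogP=> hp; apply/dhomogP => m; rewrite mcoeff_msupp mcoeff_mconj.
by rewrite conjc_eq0 -mcoeff_msupp => /hp.
Qed.

Lemma wact_mconj w p : wact w (mconj p) = mconj (wact w p).
Proof.
have wE : map_mx (@conjc R) (complex_repr w) = complex_repr w.
  by apply/matrixP => i j; rewrite !mxE conjc_real.
by rewrite /wact /mconj -{1}wE -map_sym_act.
Qed.

Lemma wact_linear_form w (v : 'rV[R]_n.+1) :
  wact w (linform (map_mx (real_complex R) v)) =
  linform (map_mx (real_complex R) (v *m rG w)).
Proof. by rewrite /wact sym_act_linform map_mxM. Qed.

Lemma root_form_neq0 t : t \in reflections W -> root_form t != 0.
Proof. by move=> rt; rewrite linform_eq0 map_mx_eq0 real_root_neq0. Qed.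

Lemma wact_root_form t : t \in reflections W ->
  wact t (root_form t) = - root_form t.
Proof.
move=> rt; rewrite wact_linear_form real_root_refl // -scaleN1r map_mxZ.
by rewrite linformZ rmorphN1 scaleN1r.
Qed.

Lemma wact_root_form_conj t v : t \in reflections W -> v \in G ->
  exists c, wact v (root_form t) = c *: root_form (t ^ v)%g.
Proof.
move=> rt Gv; have [c cE] := real_root_conj rt Gv; exists (real_complex R c).
by rewrite wact_linear_form cE map_mxZ linformZ.
Qed.

Lemma wact_sub_dvd t p : t \in reflections W ->
  exists q, wact t p - p = root_form t * q.
Proof.
move=> rt; apply: sym_act_sub_dvd; rewrite -(map_mx1 (real_complex R)).
by rewrite -map_mxB map_submx real_root_eqmx.
Qed.

(** The projection along the root of t onto the row vectors fixed by t; the induced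
    endomorphism of the polynomial ring has kernel generated by the root form. *)
Definition refl_proj (t : wtype W) : 'M[R]_n.+1 := 2^-1 *: (1%:M + rG t).

Definition hyperplane_restr (t : wtype W) : {mpoly C[n.+1]} -> {mpoly C[n.+1]} :=
  sym_act (map_mx (real_complex R) (refl_proj t)).

HB.instance Definition _ t := GRing.LRMorphism.copy (hyperplane_restr t)
  (sym_act (map_mx (real_complex R) (refl_proj t))).

Lemma hyperplane_restr_linform t v :
  hyperplane_restr t (linform (map_mx (real_complex R) v)) =
  linform (map_mx (real_complex R) (v *m refl_proj t)).
Proof. by rewrite /hyperplane_restr sym_act_linform map_mxM. Qed.

Lemma hyperplane_restr_root t : t \in reflections W ->
  hyperplane_restr t (root_form t) = 0.
Proof.
move=> rt; apply/eqP; rewrite hyperplane_restr_linform linform_eq0 map_mx_eq0.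
by rewrite -scalemxAr mulmxDr mulmx1 real_root_refl // subrr scaler0.
Qed.

Lemma hyperplane_restr_neq0 s t :
  s \in reflections W -> t \in reflections W -> s != t ->
  hyperplane_restr t (root_form s) != 0.
Proof.
move=> rs rt; apply: contraNneq => /eqP.
rewrite hyperplane_restr_linform linform_eq0 map_mx_eq0 -scalemxAr.
rewrite scaler_eq0 invr_eq0 pnatr_eq0 /= mulmxDr mulmx1 addr_eq0 => /eqP sN.
apply/eqP/(real_root_inj rs rt).
have -> : real_root s = - 2^-1 *: (real_root s *m (rG t - 1%:M)).
  rewrite mulmxBr mulmx1 -{1}[_ *m _]opprK -sN -opprD -mulr2n -scaler_nat.
  by rewrite scalerN scaleNr opprK scalerA mulVf ?pnatr_eq0 ?scale1r.
by rewrite scalemx_sub // (real_root_eqmx rt) submxMl.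
Qed.

Lemma hyperplane_restr_dvd t p : t \in reflections W ->
  hyperplane_restr t p = 0 -> exists q, p = root_form t * q.
Proof.
move=> rt p0.
have [|q] := @sym_act_sub_dvd _ _ (map_mx (real_complex R) (refl_proj t))
  (map_mx (real_complex R) (real_root t)) p.
  rewrite -(map_mx1 (real_complex R)) -map_mxB map_submx.
  have -> : refl_proj t - 1%:M = 2^-1 *: (rG t - 1%:M).
    have half : 1%:M = 2^-1 *: (1%:M *+ 2) :> 'M[R]_n.+1.
      by rewrite -scaler_nat scalerA mulVf ?pnatr_eq0 ?scale1r.
    rewrite /refl_proj {2}half -scalerBr mulr2n opprD addrA; congr (_ *: (_ - _)).
    by rewrite addrAC subrr add0r.
  by rewrite scalemx_sub // real_root_eqmx.
rewrite -/(hyperplane_restr t p) p0 sub0r => pE.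
by exists (- q); rewrite mulrN -pE opprK.
Qed.

Definition root_product := \prod_(t in reflections W) root_form t.

Lemma root_product_neq0 : root_product != 0.
Proof. by apply/prodf_neq0 => t; apply: root_form_neq0. Qed.

(** Root forms are extracted one at a time. The restriction to the hyperplane of
    t is a morphism to an integral domain that kills p and, among the root forms,
    only that of t, so it kills the cofactor of the forms already extracted. *)
Lemma skew_root_product_dvd p :
  (forall t, t \in reflections W -> wact t p = - p) ->
  exists q, p = root_product * q.
Proof.
move=> skew; rewrite /root_product -big_enum.
have: {subset enum (reflections W) <= reflections W}.
  by move=> t; rewrite mem_enum.
elim: (enum _) (enum_uniq (reflections W)) => [|t s IH] /=.
  by exists p; rewrite big_nil mul1r.
case/andP=> ts us rs; have [|q pE] := IH us.
  by move=> r sr; rewrite rs // inE sr orbT.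
have rt : t \in reflections W by rewrite rs ?mem_head.
have [r qE] : exists r, q = root_form t * r.
  apply: hyperplane_restr_dvd => //.
  have [r rE] := wact_sub_dvd p rt.
  (* t p - p is a multiple of the root form, and it is also - 2 p. *)
  have: hyperplane_restr t p = 0.
    have /eqP : hyperplane_restr t (wact t p - p) = 0.
      by rewrite rE rmorphM /= hyperplane_restr_root // mul0r.
    rewrite skew // -opprD -mulr2n -scaler_nat -scaleNr linearZ /=.
    by rewrite scaler_eq0 oppr_eq0 pnatr_eq0 => /eqP.
  rewrite pE rmorphM /= => /eqP; rewrite mulf_eq0 => /orP[|/eqP//].
  rewrite rmorph_prod prodf_seq_eq0 => /hasP[r' rs' /= /idPn[]].
  rewrite hyperplane_restr_neq0 ?rs ?inE ?rs' ?eqxx ?orbT //.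
  by apply: contraNneq ts => <-.
by exists r; rewrite big_cons pE qE mulrCA mulrA.
Qed.

End Reflections.

Opaque wact mconj.

(** * Skew polynomials *)

Section SkewPolynomials.
Variables (R : realType) (n : nat) (W : weyl_group R n.+1).
Local Notation C := (R[i] : fieldType).
Local Notation G := (wgroup W).
Local Notation rG := (wrepr W).

Local Notation Delta := (root_product W).

Lemma refl_conj_eq t v : v \in G -> ((t ^ v)%g \in reflections W) = (t \in reflections W).
Proof.
move=> Gv; apply/idP/idP => [rt|/refl_conj]; last exact.
by rewrite -(conjgK v t) refl_conj ?groupV.
Qed.

(** The sign character, read off from the action on the product of root forms;
    it is the determinant of v, for v in W. *)
Definition wsign (v : wtype W) : C :=
  (wact v Delta)@_(mlead Delta) / mleadc Delta.

(** Conjugation by v permutes the reflections, hence the root forms up to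
    scalars. *)
Lemma wact_root_product v : v \in G ->
  wact v Delta = wsign v *: Delta.
Proof.
move=> Gv; have nz : mleadc Delta != 0 by rewrite mleadc_eq0 root_product_neq0.
have [c cE] : exists c,
    wact v Delta = c *: \prod_(t in reflections W) root_form (t ^ v)%g.
  rewrite rmorph_prod /=.
  apply: (big_ind2 (fun p q => exists c, p = c *: q)).
  - by exists 1; rewrite scale1r.
  - by move=> p p' q q' [a ->] [b ->]; exists (a * b); rewrite -scalerAl -scalerAr scalerA.
  - by move=> t rt; apply: wact_root_form_conj.
have conjD : \prod_(t in reflections W) root_form (t ^ v)%g = Delta.
  rewrite /root_product [RHS](reindex_inj (conjg_inj v)) /=.
  by apply: eq_bigl => t; rewrite refl_conj_eq.
by rewrite /wsign cE conjD mcoeffZ mulfK.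
Qed.

Lemma wsign1 : wsign 1%g = 1.
Proof. by rewrite /wsign wact1 divff // mleadc_eq0 root_product_neq0. Qed.

Lemma wsignM v w : v \in G -> w \in G -> wsign (v * w)%g = wsign v * wsign w.
Proof.
move=> Gv Gw; apply/eqP; rewrite -subr_eq0.
have /eqP : (wsign (v * w)%g - wsign v * wsign w) *: Delta = 0.
  rewrite scalerBl -wact_root_product ?groupM // wactM // wact_root_product //.
  by rewrite linearZ /= wact_root_product // scalerA subrr.
by rewrite scaler_eq0 (negPf (root_product_neq0 W)) orbF.
Qed.

Lemma wsign_neq0 v : v \in G -> wsign v != 0.
Proof.
move=> Gv; have := oner_neq0 C; rewrite -wsign1 -(mulgV v) wsignM ?groupV //.
by apply: contraNneq => ->; rewrite mul0r.
Qed.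

Lemma wact_refl_inv t p : t \in reflections W -> wact t (wact t p) = p.
Proof.
move=> rt; have Gt := refl_group rt; rewrite -wactM //.
have tt : rG (t * t)%g = rG 1%g.
  rewrite repr_mxM // repr_mx1 -[LHS]/(rG t * rG t).
  by apply: neg_rank1_sqr (real_root_refl rt); rewrite real_root_eqmx.
rewrite (_ : (t * t)%g = 1%g) ?wact1 //.
exact: mx_faithful_inj (wrepr_faithful W) _ _ (groupM Gt Gt) (group1 _) tt.
Qed.

(** The sign is 1 or -1 since t is an involution. If it were 1, the product q of
    the other root forms would be changed to - q by t, hence would vanish on the
    hyperplane of t, whereas none of its factors does. *)
Lemma wsign_refl t : t \in reflections W -> wsign t = - 1.
Proof.
move=> rt; have Gt := refl_group rt; have nz := root_product_neq0 W.
have sq1 : wsign t ^+ 2 = 1.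
  apply/eqP; rewrite -subr_eq0; have /eqP : (wsign t ^+ 2 - 1) *: Delta = 0.
    rewrite scalerBl scale1r expr2 -scalerA -!wact_root_product // -linearZ /=.
    by rewrite -wact_root_product // wact_refl_inv // subrr.
  by rewrite scaler_eq0 (negPf nz) orbF.
move/eqP: sq1; rewrite sqrf_eq1 => /orP[/eqP t1|/eqP//].
pose q := \prod_(s in reflections W | s != t) root_form s.
have DE : Delta = root_form t * q by rewrite /root_product (bigD1 t).
have qN : wact t q = - q.
  apply: (mulfI (root_form_neq0 rt)); rewrite mulrN.
  have := wact_root_product Gt; rewrite t1 scale1r DE => qE.
  rewrite -[in RHS]qE rmorphM /= (wact_root_form rt).
  by rewrite mulNr opprK.
have [r rE] := wact_sub_dvd q rt.
have /eqP : hyperplane_restr t (wact t q - q) = 0.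
  by rewrite rE rmorphM /= hyperplane_restr_root // mul0r.
rewrite qN -opprD -mulr2n -scaler_nat -scaleNr linearZ /=.
rewrite scaler_eq0 oppr_eq0 pnatr_eq0 /= rmorph_prod => /prodf_eq0[s /andP[rs st]].
by rewrite (negPf (hyperplane_restr_neq0 rs rt st)).
Qed.

Definition antisymmetrize (p : {mpoly C[n.+1]}) : {mpoly C[n.+1]} :=
  \sum_(w in G) (wsign w)^-1 *: wact w p.

Local Notation Alt := antisymmetrize.

Lemma wact_antisymmetrize v p : v \in G ->
  wact v (Alt p) = wsign v *: Alt p.
Proof.
move=> Gv; rewrite /antisymmetrize linear_sum /= scaler_sumr.
rewrite [RHS](reindex_inj (mulIg v)) /=; apply: eq_big => [w|w Gw].
  by rewrite groupMr.
rewrite wactZ -(wactM _ Gw Gv) scalerA (wsignM Gw Gv).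
rewrite (invfM (wsign w)) mulrCA.
by rewrite mulfV ?wsign_neq0 // mulr1.
Qed.

Lemma antisymmetrize_wact v p : v \in G ->
  Alt (wact v p) = wsign v *: Alt p.
Proof.
move=> Gv; rewrite /antisymmetrize scaler_sumr.
rewrite [RHS](reindex_inj (mulgI v)) /=; apply: eq_big => [w|w Gw].
  by rewrite groupMl.
rewrite -(wactM _ Gv Gw) scalerA (wsignM Gv Gw) (invfM (wsign v)) mulrA.
by rewrite mulfV ?wsign_neq0 // mul1r.
Qed.

Lemma antisymmetrizeMr p q : Defs.invariant W q ->
  Alt (p * q) = Alt p * q.
Proof.
move=> inv_q; rewrite /antisymmetrize mulr_suml; apply: eq_bigr => w Gw.
by rewrite rmorphM /= (wact_invariant Gw inv_q) scalerAl.
Qed.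

Lemma antisymmetrize_linear : linear Alt.
Proof.
move=> a p q; rewrite /antisymmetrize scaler_sumr -big_split; apply: eq_bigr => w _.
by rewrite linearP /= scalerDr !scalerA mulrC.
Qed.

HB.instance Definition _ :=
  GRing.isLinear.Build C _ _ _ Alt antisymmetrize_linear.

Lemma antisymmetrize_homog d p : p \is d.-homog -> Alt p \is d.-homog.
Proof. by move=> hp; rewrite rpred_sum // => w _; rewrite rpredZ // wact_homog. Qed.

Lemma root_product_homog : Delta \is #|reflections W|.-homog.
Proof.
rewrite -sum1_card /Delta.
apply: (big_ind2 (fun p d => p \is d.-homog)) => [|p d q e|t _].
- exact: dhomog1.
- exact: dhomogM.
- exact: linform_homog.
Qed.

(** The quotient of two semi-invariants for the same character is invariant. *)
Lemma antisymmetrize_dvd d p : p \is d.-homog ->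
  exists q, [/\ Alt p = Delta * q, Defs.invariant W q &
    q \is (d - #|reflections W|).-homog /\ ((d < #|reflections W|)%N -> q = 0)].
Proof.
move=> hp; set N := #|_|; have nz := root_product_neq0 W.
have [|q AE] := @skew_root_product_dvd _ _ W (Alt p).
  move=> t rt; rewrite wact_antisymmetrize ?refl_group // wsign_refl //.
  by rewrite scaleN1r.
exists q; split=> //.
  move=> w Gw; apply: (mulfI nz); rewrite -AE.
  apply: (scalerI (wsign_neq0 Gw)); rewrite -wact_antisymmetrize // AE.
  by rewrite rmorphM /= wact_root_product // scalerAl.
have := antisymmetrize_homog hp; rewrite AE.
exact: dhomog_divl nz root_product_homog.
Qed.

End SkewPolynomials.

Opaque wsign.

(** * The coinvariant ideal *)

Section CoinvariantIdeal.
Variables (R : realType) (n : nat) (W : weyl_group R n.+1).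
Local Notation C := (R[i] : fieldType).
Local Notation G := (wgroup W).
Implicit Types p q : {mpoly C[n.+1]}.

Lemma ideal0 : coinvariant_ideal W 0.
Proof. by exists [::]; rewrite big_nil. Qed.

Lemma idealD p q :
  coinvariant_ideal W p -> coinvariant_ideal W q -> coinvariant_ideal W (p + q).
Proof.
move=> [r [inv_r ->]] [s [inv_s ->]]; exists (r ++ s); rewrite big_cat.
by split=> // gh; rewrite mem_cat => /orP[/inv_r|/inv_s].
Qed.

Lemma idealMl p q : coinvariant_ideal W q -> coinvariant_ideal W (p * q).
Proof.
move=> [r [inv_r ->]]; exists [seq (p * gh.1, gh.2) | gh <- r]; split.
  by move=> _ /mapP[gh /inv_r ? ->].
by rewrite big_map mulr_sumr; apply: eq_bigr => gh _; rewrite mulrA.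
Qed.

Lemma idealZ c p : coinvariant_ideal W p -> coinvariant_ideal W (c *: p).
Proof. by rewrite -mul_mpolyC; apply: idealMl. Qed.

Lemma ideal_sum (I : Type) (r : seq I) (P : pred I) (f : I -> {mpoly C[n.+1]}) :
  (forall i, P i -> coinvariant_ideal W (f i)) ->
  coinvariant_ideal W (\sum_(i <- r | P i) f i).
Proof. by move=> If; apply: big_ind => //; [exact: ideal0 | exact: idealD]. Qed.

Lemma ideal_invariant d q : (0 < d)%N -> q \is d.-homog -> Defs.invariant W q ->
  coinvariant_ideal W q.
Proof.
move=> d_gt0 hq inv_q; exists [:: (1, q)]; rewrite big_seq1 mul1r; split=> // gh.
by rewrite inE => /eqP ->; split=> //; exists d.
Qed.

Lemma ideal_wact v p : v \in G -> coinvariant_ideal W p ->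
  coinvariant_ideal W (wact v p).
Proof.
move=> Gv [r [inv_r ->]]; exists [seq (wact v gh.1, gh.2) | gh <- r]; split.
  by move=> _ /mapP[gh /inv_r ? ->].
rewrite big_map linear_sum /= !big_seq; apply: eq_bigr => gh /inv_r[inv _].
by rewrite rmorphM /= (wact_invariant Gv inv).
Qed.

(** If p is the sum of the g_j h_j with h_j invariant, then t p - p is the sum of the
    (t g_j - g_j) h_j, and each t g_j - g_j is a multiple of the root form. *)
Lemma ideal_wact_sub t p : t \in reflections W -> coinvariant_ideal W p ->
  exists2 q, coinvariant_ideal W q & wact t p - p = root_form t * q.
Proof.
move=> rt [r [inv_r ->]]; elim: r inv_r => [|gh r IH] inv_r.
  by exists 0; [exact: ideal0 | rewrite big_nil mulr0 linear0 subr0].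
have [|q Iq qE] := IH; first by move=> gh' r_gh'; apply: inv_r; rewrite inE r_gh' orbT.
have [inv_h [d d_gt0 hh]] := inv_r gh (mem_head _ _).
have [g gE] := wact_sub_dvd gh.1 rt.
exists (g * gh.2 + q).
  by apply: idealD Iq; apply/idealMl/(ideal_invariant d_gt0).
rewrite big_cons linearD /= rmorphM /= (wact_invariant (refl_group rt) inv_h).
by rewrite opprD addrACA qE -(mulrBl _ (wact t gh.1)) gE mulrDr mulrA.
Qed.

(** Evaluate at the variable x the product of the T - w x over w in W: the value
    is zero, and the coefficients other than the leading one are homogeneous
    invariants of positive degree. *)
Lemma varX_card_ideal i : coinvariant_ideal W ('X_i ^+ #|G|).
Proof.
pose s := [seq wact w 'X_i | w <- enum G].
pose P := \prod_(a <- s) ('X - a%:P).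
have size_s : size s = #|G| by rewrite size_map cardE.
have sizeP : size P = #|G|.+1 by rewrite size_prod_XsubC size_s.
have : P.[ 'X_i ] = 0.
  apply/rootP; rewrite root_prod_XsubC; apply/mapP; exists 1%g; last by rewrite wact1.
  by rewrite mem_enum.
rewrite horner_coef sizeP big_ord_recr /=.
have -> : P`_#|G| = 1.
  have := monic_prod_XsubC s xpredT id.
  by rewrite /= monicE lead_coefE -/P sizeP => /eqP.
rewrite mul1r => /eqP; rewrite addrC addr_eq0 => /eqP ->.
rewrite -scaleN1r; apply/idealZ/ideal_sum => k _; rewrite mulrC; apply: idealMl.
apply: (@ideal_invariant (#|G| - k)%N).
- by rewrite subn_gt0.
- have -> : (#|G| - k = size s - k)%N by rewrite size_s.
  apply: homog_coef_prodXsubC; last by rewrite size_s ltnW.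
  apply/allP=> _ /mapP[w _ ->]; apply: wact_homog.
  by rewrite dhomogX /= mdeg1.
- move=> v Gv; rewrite -/(wact v _) -coef_map /= rmorph_prod /= big_map big_enum /=.
  rewrite /P big_map big_enum /=; congr (nth _ (polyseq _) _).
  rewrite [RHS](reindex_inj (mulIg v)) /=; apply: eq_big => [w|w Gw].
    by rewrite groupMr.
  by rewrite rmorphB /= map_polyX map_polyC /= wactM.
Qed.

(** A monomial of such a degree has a variable with exponent at least |W|. *)
Lemma ideal_high_degree d p : p \is d.-homog -> (n.+1 * #|G| <= d)%N ->
  coinvariant_ideal W p.
Proof.
move=> /dhomogP hp d_ge; rewrite [p]mpolyE big_seq; apply: ideal_sum => m /hp/= md.
apply: idealZ.
have [i mi] : exists i, (#|G| <= m i)%N.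
  apply/existsP; rewrite -[[exists _, _]]negbK negb_exists; apply/negP => /forallP lt.
  move: d_ge; rewrite -md mdegE leqNgt => /negP[].
  have -> : (n.+1 * #|G| = \sum_(i < n.+1) #|G|)%N by rewrite sum_nat_const card_ord.
  rewrite big_ord_recl [ltnLHS]big_ord_recl -addSn leq_add //.
    by rewrite ltnNge lt.
  by apply: leq_sum => j _; rewrite ltnW // ltnNge lt.
rewrite mpolyXE_id (bigD1 i) //= mulrC -(subnK mi) exprD mulrA.
exact/idealMl/varX_card_ideal.
Qed.

End CoinvariantIdeal.

(** * Poincare duality of the coinvariant algebra *)

Section PoincareDuality.
Variables (R : realType) (n : nat) (W : weyl_group R n.+1).
Local Notation C := (R[i] : fieldType).
Local Notation G := (wgroup W).
Local Notation rG := (wrepr W).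
Implicit Types p q : {mpoly C[n.+1]}.
Local Notation N := #|reflections W|.
Local Notation Alt := (antisymmetrize W).

Lemma wrefl_reflections i : wrefl W i \in reflections W.
Proof.
have Gi : wrefl W i \in G by exact: wrefl_group.
have [a_roots _ _] := wsimpleP W.
have a0 : wsimple W i != 0.
  by apply: contraNneq (roots_neq0 (wrootsP W)) => <-.
have aE : wsimple W i *m rG (wrefl W i) = - wsimple W i.
  have [_ /(_ _ a0) dot_gt0] := wgramP W.
  rewrite wreflE /reflection mulfK ?gt_eqF // scaler_nat mulr2n opprD addrA.
  by rewrite subrr sub0r.
rewrite inE Gi eqn_leq lt0n mxrank_eq0; apply/and3P; split=> //.
  suff s : (rG (wrefl W i) - 1%:M <= wsimple W i)%MS.
    by rewrite (leq_trans (mxrankS s)) // rank_rV a0.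
  apply/row_subP => j; rewrite rowE mulmxBr mulmx1 wreflE /reflection.
  by rewrite addrAC subrr sub0r -scaleNr scalemx_sub.
rewrite subr_eq0; apply: contra_neq a0 => s1; move/eqP: aE.
by rewrite s1 mulmx1 -subr_eq0 opprK -mulr2n -scaler_nat scaler_eq0 pnatr_eq0 => /eqP.
Qed.

(** The first hypothesis gives that p + t p is in the ideal for each reflection t;
    the elements w that act on the class of p by their sign form a group, which
    is therefore W, and p is congruent to its average Alt p / |W|. *)
Lemma ideal_antisymmetrize p :
  (forall t, t \in reflections W -> coinvariant_ideal W (root_form t * p)) ->
  coinvariant_ideal W (Alt p) -> coinvariant_ideal W p.
Proof.
move=> Ip IAp.
have refl t : t \in reflections W -> coinvariant_ideal W (p + wact t p).
  move=> rt; have [q Iq qE] := ideal_wact_sub rt (Ip t rt).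
  (* t (alpha p) - alpha p = - alpha (p + t p) *)
  have -> : p + wact t p = - 1 *: q; last exact: idealZ.
  apply: (mulfI (root_form_neq0 rt)); rewrite scaleN1r mulrN -qE rmorphM /=.
  by rewrite (wact_root_form rt) mulrDr mulNr opprB opprK addrC.
pose H := [set w in G | `[< coinvariant_ideal W (p - (wsign w)^-1 *: wact w p) >]].
have groupH : group_set H.
  apply/group_setP; split=> [|v w].
    rewrite inE group1; apply/asboolP; rewrite wsign1 wact1 invr1 scale1r subrr.
    exact: ideal0.
  rewrite !inE => /andP[Gv /asboolP Iv] /andP[Gw /asboolP Iw].
  rewrite groupM //; apply/asboolP.
  have := idealD Iw (idealZ (wsign w)^-1 (ideal_wact Gw Iv)).
  rewrite wactB wactZ -(wactM _ Gv Gw).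
  move: (wact w p) (wact (v * w)%g p) => x y.
  rewrite (wsignM Gv Gw); move: (wsign v) (wsign w) => a b.
  rewrite scalerBr scalerA addrA subrK.
  by rewrite invfM mulrC.
have GH : G \subset Group groupH.
  rewrite -(wgroup_gen W) gen_subG; apply/subsetP => _ /imsetP[i _ ->].
  have rt := wrefl_reflections i.
  rewrite inE wrefl_group; apply/asboolP.
  by rewrite wsign_refl // invrN1 scaleN1r opprK; apply: refl.
have Isum : coinvariant_ideal W (\sum_(w in G) (p - (wsign w)^-1 *: wact w p)).
  apply: ideal_sum => w /(subsetP GH); rewrite inE => /andP[_].
  exact: asboolW.
have G0 : #|G|%:R != 0 :> C by rewrite pnatr_eq0 -lt0n cardG_gt0.
have -> : p = #|G|%:R^-1 *: (\sum_(w in G) (p - (wsign w)^-1 *: wact w p) + Alt p).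
  rewrite /antisymmetrize -big_split /=.
  under eq_bigr do rewrite subrK.
  by rewrite sumr_const -[p *+ _]scaler_nat scalerA mulVf ?scale1r.
by apply/idealZ/idealD.
Qed.

(** The radical of the duality pairing, for every degree d at once: when d > N
    the hypothesis is empty and the conclusion says that the coinvariants of
    degree d vanish. *)
Lemma coinvariant_pairing_nondeg d p : p \is d.-homog ->
  (forall e q, (d + e)%N = N -> q \is e.-homog -> Alt (p * q) = 0) ->
  coinvariant_ideal W p.
Proof.
(* Downward induction on d; nothing is left to prove from degree (n + 1) |W| on. *)
move: {2}(n.+1 * #|G| - d)%N (leqnn (n.+1 * #|G| - d)) => k.
elim: k d p => [|k IH] d p dk hp p_perp.
  by apply: (ideal_high_degree hp); rewrite -subn_eq0 -leqn0.
apply: ideal_antisymmetrize => [t rt|].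
  apply: (IH d.+1); first by rewrite subnS -subn1 leq_subLR add1n.
    exact: dhomogM (linform_homog _) hp.
  move=> e q de hq; rewrite mulrAC mulrC; apply: (p_perp e.+1).
    by rewrite addnS -addSn.
  exact: dhomogM (linform_homog _) hq.
have [q [AE inv_q [hq q0]]] := antisymmetrize_dvd W hp.
have [dN|Nd|dN] := ltngtP d N.
- by rewrite AE q0 // mulr0; apply: ideal0.
- by rewrite AE; apply/idealMl/(ideal_invariant _ hq inv_q); rewrite subn_gt0.
- have -> : Alt p = 0; last exact: ideal0.
  by rewrite -[p]mulr1; apply: (p_perp 0%N); rewrite ?addn0 ?dhomog1.
Qed.

End PoincareDuality.

(** * Linear algebra: representing pairings, maps between quotients *)

Section VectorSpaces.
Variable F : fieldType.

(** A subspace of largest dimension among those contained in P absorbs each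
    vector of P. *)
Lemma memv_span_pred (V : vectType F) (P : V -> Prop) v :
  P 0 -> (forall a x y, P x -> P y -> P (a *: x + y)) ->
  (v \in span_pred P) <-> P v.
Proof.
move=> P0 PZD; split; last exact: mem_span_pred.
pose Q d := `[< exists2 X : {vspace V}, \dim X = d & forall u, u \in X -> P u >].
have exQ : exists d, Q d.
  by exists 0%N; apply/asboolP; exists 0%VS => [|u]; rewrite ?dimv0 // memv0 => /eqP->.
have boundQ d : Q d -> (d <= \dim {:V})%N.
  by move=> /asboolP[X <- _]; apply/dimvS/subvf.
case: (ex_maxnP exQ boundQ) => d /asboolP[X dimX PX] maxd.
suff sX : (span_pred P <= X)%VS by move/(subvP sX)/PX.
apply/span_predP => w Pw.
suff /eqP -> : X == (X + <[w]>)%VS by rewrite (subvP (addvSr _ _)) ?memv_line.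
rewrite eqEdim addvSl dimX; apply/maxd/asboolP; exists (X + <[w]>)%VS => // u.
by case/memv_addP=> x Xx [_ /vlineP[k ->] ->]; rewrite addrC; apply: (PZD) (PX _ Xx).
Qed.

(** A nondegenerate form b represents each functional g x as some b (h x), and h
    can be chosen linear in x. *)
Lemma bilinear_represent (U V : vectType F) (b : V -> V -> F) (g : U -> V -> F) :
  (forall y, scalar (b^~ y)) -> (forall x, scalar (b x)) ->
  (forall y, scalar (g^~ y)) -> (forall x, scalar (g x)) ->
  (forall x, (forall y, b x y = 0) -> x = 0) ->
  exists h : 'Hom(U, V), forall x y, b (h x) y = g x y.
Proof.
move=> bl br gl gr b_nd.
pose e := vbasis {:V}.
have ext (f f' : V -> F) : scalar f -> scalar f' ->
    (forall j : 'I_(\dim {:V}), f e`_j = f' e`_j) -> f =1 f'.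
  move=> lf lf' ff' y.
  have f0 (k : V -> F) : scalar k -> k 0 = 0.
    by move=> lk; rewrite -{1}[0](addNr 0) -scaleN1r lk mulN1r addNr.
  rewrite (coord_vbasis (memvf y)).
  apply: (big_ind (fun z => f z = f' z)) => [|u v fu fv|j _]; first by rewrite !f0.
    by rewrite -[u]scale1r lf lf' fu fv.
  by rewrite -[_ *: _]addr0 lf lf' ff' !f0.
pose B x := \row_j b x e`_j : 'rV[F]_(\dim {:V}).
pose D x := \row_j g x e`_j : 'rV[F]_(\dim {:V}).
have linB : linear B by move=> a x y; apply/rowP => j; rewrite !mxE bl.
have linD : linear D by move=> a x y; apply/rowP => j; rewrite !mxE gl.
pose BL : {linear V -> 'rV[F]_(\dim {:V})} :=
  HB.pack B (GRing.isLinear.Build F _ _ _ B linB).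
pose DL : {linear U -> 'rV[F]_(\dim {:V})} :=
  HB.pack D (GRing.isLinear.Build F _ _ _ D linD).
have kerB : lker (linfun BL) == 0%VS.
  apply/lker0P => x y; rewrite !lfunE /= => Bxy; apply/eqP.
  rewrite -subr_eq0; apply/eqP/b_nd.
  apply: (ext _ (fun=> 0)) => // [a z t|j]; first by rewrite mulr0 addr0.
  have /rowP/(_ j) := Bxy; rewrite !mxE.
  by move=> E; rewrite addrC -scaleN1r bl E mulN1r addNr.
have imB : limg (linfun BL) = fullv.
  apply/eqP; rewrite eqEdim subvf /= limg_dim_eq ?dimvf ?(eqP kerB) ?capv0 //.
  by rewrite /dim /= mul1n.
exists ((linfun BL)^-1 \o linfun DL)%VF => x.
apply: ext; [exact: br|exact: gr|move=> j].
have /rowP/(_ j) : B (((linfun BL)^-1 \o linfun DL)%VF x) = D x.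
  rewrite -[B _]/(BL _) -[LHS](lfunE BL) comp_lfunE /= limg_lfunVK ?imB ?memvf //.
  exact: (lfunE DL).
by rewrite !mxE.
Qed.

End VectorSpaces.

Section Quotients.
Variables (F : fieldType) (V V' : vectType F) (U : {vspace V}) (U' : {vspace V'}).

Definition quotv_hom (f : 'Hom(V, V')) : 'Hom(quotv U, quotv U') :=
  (quotv_pi U' \o f \o linfun (@vsval F V (U^C)%VS))%VF.

Lemma quotv_hom_val f x : quotv_hom f x = quotv_pi U' (f (vsval x)).
Proof. by rewrite /quotv_hom; move: (quotv_pi U') => p; rewrite !comp_lfunE lfunE. Qed.

Lemma quotv_homE f v : (f @: U <= U')%VS ->
  quotv_hom f (quotv_pi U v) = quotv_pi U' (f v).
Proof.
move=> sfU; rewrite quotv_hom_val quotv_piE !linearB /=.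
apply/eqP; rewrite -subr_eq0 addrAC subrr sub0r oppr_eq0 -memv_ker.
by rewrite lker_quotv_pi (subvP sfU) // memv_img ?memv_proj.
Qed.

Lemma lker_quotv_hom f : (f @^-1: U' <= U)%VS -> lker (quotv_hom f) == 0%VS.
Proof.
move=> sU; rewrite -subv0; apply/subvP => x; rewrite memv_ker memv0 quotv_hom_val.
rewrite -memv_ker lker_quotv_pi memv_preim => /(subvP sU).
have <- : (vsval x \in lker (quotv_pi U)) = (vsval x \in U) by rewrite lker_quotv_pi.
by rewrite memv_ker quotv_piK.
Qed.

Lemma quotv_surj (x : quotv U) : exists v, x = quotv_pi U v.
Proof. by exists (vsval x); rewrite quotv_piK. Qed.

End Quotients.

(** * An invariant form on homogeneous polynomials *)

Section InvariantForm.
Variables (R : realType) (n : nat) (W : weyl_group R n.+1).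
Local Notation C := (R[i] : fieldType).
Local Notation G := (wgroup W).
Implicit Types p q : {mpoly C[n.+1]}.
Local Notation N := #|reflections W|.
Local Notation Alt := (antisymmetrize W).
Local Notation Delta := (root_product W).

Lemma ideal_mconj p : coinvariant_ideal W p -> coinvariant_ideal W (mconj p).
Proof.
move=> [r [inv_r ->]]; rewrite raddf_sum big_seq /=.
apply: ideal_sum => gh /inv_r[inv [d d_gt0 hh]]; rewrite rmorphM; apply: idealMl.
apply: (ideal_invariant d_gt0); first exact: mconj_homog.
by move=> w Gw; rewrite -[LHS]/(wact w _) wact_mconj (wact_invariant Gw inv).
Qed.

(** The coefficient of Delta in Alt p, up to the nonzero leading coefficient of
    Delta, when p is homogeneous of the degree of Delta. *)
Definition top_coef p : C := (Alt p)@_(mlead Delta).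

Lemma top_coef_linear : scalar top_coef.
Proof. by move=> a p q; rewrite /top_coef linearP /= mcoeffD mcoeffZ. Qed.

Lemma top_coef_wact v p : v \in G -> top_coef (wact v p) = wsign v * top_coef p.
Proof. by move=> Gv; rewrite /top_coef antisymmetrize_wact // mcoeffZ. Qed.

Lemma top_coef_eq0 p : p \is N.-homog -> top_coef p = 0 -> Alt p = 0.
Proof.
move=> /(antisymmetrize_dvd W)[q [AE _ [hq _]]]; rewrite subnn in hq.
have qC : q = (q@_0)%:MP.
  apply/mpolyP => m; rewrite mcoeffC; have [->|m0] := eqVneq 0%MM m.
    by rewrite mulr1.
  by rewrite mulr0 (dhomog_nemf_coeff hq) // mdeg_eq0 eq_sym.
rewrite /top_coef AE qC mulrC mul_mpolyC mcoeffZ => /eqP.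
rewrite mulf_eq0 mleadc_eq0 (negPf (root_product_neq0 W)) orbF => /eqP ->.
by rewrite scale0r.
Qed.

(** For g h with h invariant, Alt (g h) = (Alt g) h is Delta times a polynomial
    without constant term; in the degree of Delta the cofactor is constant. The
    multipliers g are arbitrary, so that this is argued on constant terms and not
    on degrees. *)
Lemma ideal_top_coef p : p \is N.-homog -> coinvariant_ideal W p -> top_coef p = 0.
Proof.
move=> hp [r [inv_r pE]].
have [s [sE s0]] : exists s, Alt p = Delta * s /\ s@_0 = 0.
  rewrite {}pE {hp}; elim: r inv_r => [|gh r IH] inv_r.
    by exists 0; rewrite big_nil mulr0 mcoeff0 linear0.
  have [|s [sE s0]] := IH; first by move=> gh' r_gh'; apply: inv_r; rewrite inE r_gh' orbT.
  have [inv_h [d d_gt0 hh]] := inv_r gh (mem_head _ _).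
  have [|q qE] := @skew_root_product_dvd _ _ W (Alt gh.1).
    move=> t rt; rewrite wact_antisymmetrize ?refl_group // wsign_refl //.
    by rewrite scaleN1r.
  exists (q * gh.2 + s); rewrite big_cons linearD /= antisymmetrizeMr // sE qE.
  rewrite mulrDr mulrA; split=> //; rewrite mcoeffD s0 addr0 rmorphM /=.
  by rewrite (dhomog_nemf_coeff hh) ?mulr0 // mf0 eq_sym -lt0n.
have := antisymmetrize_homog W hp; rewrite sE => hDs.
have [hs _] := dhomog_divl (root_product_neq0 W) (root_product_homog W) hDs.
rewrite subnn in hs; rewrite /top_coef sE.
suff -> : s = 0 by rewrite mulr0 mcoeff0.
apply/mpolyP => m; rewrite mcoeff0; have [->//|m0] := eqVneq m 0%MM.
by rewrite (dhomog_nemf_coeff hs) // mdeg_eq0.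
Qed.

(** The standard form in the monomial basis in degrees at most e, averaged over
    W (up to the factor |W|). *)
Definition invariant_form e p q : C :=
  \sum_(w in G) \sum_(m : 'X_{1..n.+1 < e.+1}) (wact w p)@_m * (wact w q)@_m.

Lemma invariant_formC e p q : invariant_form e p q = invariant_form e q p.
Proof.
rewrite /invariant_form; apply: eq_bigr => w _.
by apply: eq_bigr => m _; apply: mulrC.
Qed.

Lemma invariant_form_linear e q : scalar (fun p => invariant_form e p q).
Proof.
move=> a p p'; rewrite /invariant_form mulr_sumr -big_split; apply: eq_bigr => w _.
rewrite mulr_sumr -big_split; apply: eq_bigr => m _ /=.
by rewrite linearP /= mcoeffD mcoeffZ mulrDl mulrA.
Qed.

Lemma invariant_form_wact e v p q : v \in G ->
  invariant_form e (wact v p) (wact v q) = invariant_form e p q.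
Proof.
move=> Gv; rewrite /invariant_form [RHS](reindex_inj (mulgI v)) /=.
have GE w : (v * w \in G)%g = (w \in G) by apply: groupMl.
rewrite [RHS](eq_bigl _ _ GE); apply: eq_bigr => w Gw.
by apply: eq_bigr => m _; rewrite !(wactM _ Gv Gw).
Qed.

(** The form at p and its conjugate is a sum of squared absolute values, among
    which the terms of w = 1 are those of the coefficients of p. *)
Lemma invariant_form_mconj e p : p \is e.-homog ->
  invariant_form e p (mconj p) = 0 -> p = 0.
Proof.
move=> hp; have term_ge0 (w : wtype W) (m : 'X_{1..n.+1}) :
    0 <= (wact w p)@_m * (wact w (mconj p))@_m.
  have nonneg (x y : R[i]) : y = conjc x -> 0 <= x * y by move=> ->; exact: mulcJ_ge0.
  by apply: nonneg; rewrite wact_mconj; apply: mcoeff_mconj.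
rewrite /invariant_form => form0.
have /psumr_eq0P p0 : \sum_(m : 'X_{1..n.+1 < e.+1})
    (wact (1%g : wtype W) p)@_m * (wact (1%g : wtype W) (mconj p))@_m = 0.
  apply: (psumr_eq0P (P := mem G) _ form0 (group1 _)) => w _.
  by apply: sumr_ge0 => m _; apply: term_ge0.
apply/mpolyP => m; rewrite mcoeff0.
have [m_e|m_e] := ltnP (mdeg m) e.+1; last first.
  by rewrite (dhomog_nemf_coeff hp) // neq_ltn m_e orbT.
have /eqP := p0 (fun m _ => term_ge0 1%g (bmnm m)) (BMultinom m_e) isT.
by rewrite !wact1 (mcoeff_mconj p) mulf_eq0 conjc_eq0 orbb => /eqP.
Qed.

End InvariantForm.

(** * Self-duality of the coinvariant algebra up to sign *)

Section CoinvariantDuality.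
Variables (R : realType) (n : nat) (W : weyl_group R n.+1).
Local Notation C := (R[i] : fieldType).
Local Notation G := (wgroup W).
Implicit Types p q : {mpoly C[n.+1]}.
Local Notation N := #|reflections W|.
Local Notation Sym k := (dhomog n.+1 (R[i] : fieldType) k).

Lemma mem_coinvariant_relations k (p : Sym k) :
  (p \in coinvariant_relations W k) <-> coinvariant_ideal W p.
Proof.
apply: memv_span_pred => [|a x y Ix Iy]; first exact: ideal0.
by apply/idealD/Iy/idealZ.
Qed.

Lemma sym_power_wact (w : wtype W) k (p : Sym k) :
  mpoly_of_dhomog (sym_power (complex_repr w) k p) = wact w p.
Proof. by rewrite sym_powerE. Qed.

Lemma invariant_form_nondeg e (x : Sym e) :
  (forall q : Sym e, invariant_form W e x q = 0) -> x = 0.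
Proof.
move=> x0; apply: val_inj => /=; have hx := dhomog_is_dhomog x.
by apply: (invariant_form_mconj hx); apply: (x0 (DHomog (mconj_homog hx))).
Qed.

Lemma invariant_form0 e q : invariant_form W e 0 q = 0.
Proof.
have := invariant_form_linear W e q (-1) 0 0.
by rewrite scaler0 addr0 mulN1r addNr.
Qed.

Lemma dual_hom_exists d e : exists theta : 'Hom(Sym d, Sym e),
  forall (p : Sym d) (q : Sym e), invariant_form W e (theta p) q =
    top_coef W (mpoly_of_dhomog p * mpoly_of_dhomog q).
Proof.
apply: (@bilinear_represent _ _ _
  (fun x y : Sym e => invariant_form W e x y)
  (fun (p : Sym d) (q : Sym e) =>
     top_coef W (mpoly_of_dhomog p * mpoly_of_dhomog q))).
- by move=> y a x x'; apply: invariant_form_linear.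
- move=> x a y y'; rewrite ![invariant_form W e x _]invariant_formC.
  exact: invariant_form_linear.
- by move=> y a x x'; rewrite linearP /= mulrDl -scalerAl top_coef_linear.
- by move=> x a y y'; rewrite linearP /= mulrDr -scalerAr top_coef_linear.
- exact: invariant_form_nondeg.
Qed.

Section Duality.
Variables (d e : nat) (theta : 'Hom(Sym d, Sym e)).
Hypothesis de : (d + e)%N = N.
Hypothesis thetaE : forall (p : Sym d) (q : Sym e),
  invariant_form W e (theta p) q =
  top_coef W (mpoly_of_dhomog p * mpoly_of_dhomog q).

Lemma dual_pairing_homog (p : Sym d) (q : Sym e) :
  mpoly_of_dhomog p * mpoly_of_dhomog q \is N.-homog.
Proof.
by rewrite -de; exact: dhomogM (dhomog_is_dhomog p) (dhomog_is_dhomog q).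
Qed.

Lemma dual_hom_ideal (p : Sym d) : coinvariant_ideal W p -> theta p = 0.
Proof.
move=> Ip; apply: invariant_form_nondeg => q; rewrite thetaE.
apply: (ideal_top_coef (dual_pairing_homog p q)); rewrite mulrC.
exact: idealMl.
Qed.

(** theta p is orthogonal to the ideal, which is stable under conjugation; if
    theta p is in the ideal too, then it is orthogonal to its conjugate, hence
    zero, and p is in the radical of the duality pairing. *)
Lemma dual_hom_ideal_inv (p : Sym d) :
  coinvariant_ideal W (theta p) -> coinvariant_ideal W p.
Proof.
move=> It; have hth := dhomog_is_dhomog (theta p).
pose c : Sym e := DHomog (mconj_homog hth).
have form0 : invariant_form W e (theta p) c = 0.
  rewrite thetaE; apply: (ideal_top_coef (dual_pairing_homog p c)).
  exact/idealMl/ideal_mconj.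
have theta0 : theta p = 0.
  by apply: val_inj; apply: (invariant_form_mconj hth form0).
apply: (coinvariant_pairing_nondeg (dhomog_is_dhomog p)) => e' q de' hq.
have ee : e' = e by apply: (@addnI d); rewrite de de'.
move: hq; rewrite {}ee {de'} => hq.
apply: (top_coef_eq0 (dual_pairing_homog p (DHomog hq))).
rewrite -[X in top_coef W X]/(mpoly_of_dhomog p * mpoly_of_dhomog (DHomog hq)).
by rewrite -thetaE theta0 invariant_form0.
Qed.

(** Both forms are compared on theta (t p) and q: the duality pairing is changed
    by the sign -1 under t, the invariant form is not. *)
Lemma dual_hom_refl t (p : Sym d) : t \in reflections W ->
  theta (sym_power (complex_repr t) d p) = - sym_power (complex_repr t) e (theta p).
Proof.
move=> rt; have Gt := refl_group rt; apply/eqP; rewrite -addr_eq0; apply/eqP.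
apply: invariant_form_nondeg => q.
pose tq := sym_power (complex_repr t) e q.
have E : invariant_form W e (sym_power (complex_repr t) e (theta p)) q =
    invariant_form W e (theta p) tq.
  rewrite sym_power_wact -(invariant_form_wact e (theta p) tq Gt).
  by rewrite sym_power_wact wact_refl_inv.
have -> : invariant_form W e
    (theta (sym_power (complex_repr t) d p) + sym_power (complex_repr t) e (theta p)) q
  = invariant_form W e (theta (sym_power (complex_repr t) d p)) q +
    invariant_form W e (sym_power (complex_repr t) e (theta p)) q.
  by rewrite -[in LHS](scale1r (theta _)) invariant_form_linear mul1r.
rewrite E !thetaE sym_power_wact.
have -> : wact t p * mpoly_of_dhomog q = wact t (mpoly_of_dhomog p * mpoly_of_dhomog tq).
  by rewrite rmorphM /= sym_power_wact wact_refl_inv.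
by rewrite (top_coef_wact _ Gt) (wsign_refl rt) mulN1r addNr.
Qed.

End Duality.

Lemma coinvariants_duality d e : (d + e)%N = N ->
  exists theta : 'Hom(coinvariants W d, coinvariants W e),
    lker theta == 0%VS /\
    forall i x, theta (coinvariant_act W d i x) = - coinvariant_act W e i (theta x).
Proof.
move=> de; have [th thE] := dual_hom_exists d e.
have th_rel : (th @: coinvariant_relations W d <= coinvariant_relations W e)%VS.
  apply/subvP => _ /memv_imgP[p /mem_coinvariant_relations Ip ->].
  by rewrite (dual_hom_ideal de thE Ip) mem0v.
exists (quotv_hom _ _ th); split.
  apply: lker_quotv_hom; apply/subvP => p; rewrite -memv_preim.
  move/mem_coinvariant_relations/(dual_hom_ideal_inv de thE).
  by move/mem_coinvariant_relations.
move=> i x; have [p ->] := quotv_surj x.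
rewrite coinvariant_actE !(quotv_homE _ th_rel) coinvariant_actE -linearN.
by rewrite dual_hom_refl ?wrefl_reflections.
Qed.

Lemma coinvariants_high_degree k : (N < k)%N -> forall x : coinvariants W k, x = 0.
Proof.
move=> Nk x; have [p ->] := quotv_surj x; apply/eqP.
rewrite -memv_ker lker_quotv_pi; apply/mem_coinvariant_relations.
apply: (coinvariant_pairing_nondeg (dhomog_is_dhomog p)) => e q ke _.
by move: Nk; rewrite -ke ltnNge leq_addr.
Qed.

End CoinvariantDuality.

(** * Twisting by the sign does not change spin multiplicities *)

Section ParityTwist.
Import VectorInternalTheory.
Variables (F : fieldType) (I : Type).

Lemma tens_lfunNN (U U' V V' : vectType F) (f : 'Hom(U, U')) (g : 'Hom(V, V')) :
  tens_lfun (- f) (- g) = tens_lfun f g.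
Proof.
have f2mxN (X Y : vectType F) (h : 'Hom(X, Y)) : f2mx (- h) = - f2mx h.
  apply/row_matrixP => i; rewrite linearN /= !rowE -[delta_mx 0 i]r2vK.
  by rewrite -!v2r_lfun opp_lfunE linearN.
apply/lfunP => A; rewrite !tens_lfun_mxE !f2mxN [(- _)^T]linearN /=.
by rewrite mulNmx mulmxN mulNmx opprK.
Qed.

(** The grading involution, (-1)^b on the component of degree b. *)
Definition parity (M : supermod F I) : 'End(M) :=
  daddv_pi (sgrade M false) (sgrade M true) -
  daddv_pi (sgrade M true) (sgrade M false).

Lemma grade_direct (M : supermod F I) b :
  (sgrade M b :&: sgrade M (~~ b) = 0)%VS.
Proof. by case: b; rewrite /= ?sgrade_direct // capvC sgrade_direct. Qed.

Lemma daddv_pi_cross (V : vectType F) (X Y : {vspace V}) x :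
  (X :&: Y = 0)%VS -> x \in Y -> daddv_pi X Y x = 0.
Proof.
move=> XY Yx; have YX : (Y :&: X = 0)%VS by rewrite capvC.
have xXY : x \in (X + Y)%VS by rewrite (subvP (addvSr _ _)).
have := daddv_pi_add XY xXY; rewrite (daddv_pi_id YX Yx) => /eqP.
by rewrite -subr_eq0 addrK => /eqP.
Qed.

Lemma parityE (M : supermod F I) b x : x \in sgrade M b ->
  parity M x = (-1) ^+ b *: x.
Proof.
move=> xb; rewrite add_lfunE opp_lfunE.
have := grade_direct M b; have := grade_direct M (~~ b); rewrite negbK.
case: b xb => /= xb d1 d2; rewrite (daddv_pi_id d2 xb) (daddv_pi_cross d1 xb).
  by rewrite sub0r expr1 scaleN1r.
by rewrite subr0 expr0 scale1r.
Qed.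

Lemma supermod_ind (M : supermod F I) (P : M -> Prop) :
  (forall x y, P x -> P y -> P (x + y)) ->
  (forall b x, x \in sgrade M b -> P x) -> forall x, P x.
Proof.
move=> PD Pb x; have := memvf x; rewrite -(sgrade_full M).
by case/memv_addP=> x0 M0 [x1 M1 ->]; exact: PD (Pb _ _ M0) (Pb _ _ M1).
Qed.

Lemma parityK (M : supermod F I) : (parity M \o parity M)%VF = \1%VF.
Proof.
apply/lfunP; apply: (@supermod_ind M) => [x y Px Py|b x xb].
  by rewrite !linearD /= Px Py.
rewrite comp_lfunE id_lfunE (parityE xb) linearZ /= (parityE xb) scalerA.
by rewrite -signr_addb addbb scale1r.
Qed.

Lemma parity_sgen (M : supermod F I) i :
  (parity M \o sgen M i)%VF = - (sgen M i \o parity M)%VF.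
Proof.
apply/lfunP; apply: (@supermod_ind M) => [x y Px Py|b x xb].
  by rewrite !linearD /= Px Py.
rewrite opp_lfunE !comp_lfunE (parityE xb) linearZ /=.
have sxb : sgen M i x \in sgrade M (~~ b).
  by rewrite (subvP (sgen_odd M i b)) ?memv_img.
by rewrite (parityE sxb) signrN scaleNr.
Qed.

Lemma parity_pi (M : supermod F I) b :
  (parity M \o daddv_pi (sgrade M b) (sgrade M (~~ b)) =
   daddv_pi (sgrade M b) (sgrade M (~~ b)) \o parity M)%VF.
Proof.
apply/lfunP; apply: (@supermod_ind M) => [x y Px Py|c x xc].
  by rewrite !linearD /= Px Py.
rewrite !comp_lfunE (parityE xc) linearZ /=.
have [bc|cb] : c = b \/ c = ~~ b by case: b c {xc} => [] []; auto.
  by rewrite -bc (daddv_pi_id (grade_direct M c) xc) (parityE xc).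
rewrite cb in xc.
by rewrite (daddv_pi_cross (grade_direct M b) xc) linear0 scaler0.
Qed.

(** Composition with the tensor product of the grading involution and theta: two
    signs cancel, one from the anticommutation of the involution with the odd
    generators, and one from theta. *)
Lemma superHom_parity_twist (M chi : supermod F I) (V V' : vectType F)
    (g : I -> 'End(V)) (g' : I -> 'End(V')) (theta : 'Hom(V, V')) :
  lker theta == 0%VS -> (forall i x, theta (g i x) = - g' i (theta x)) ->
  (\dim (superHom chi (tens_supermod M g)) <=
   \dim (superHom chi (tens_supermod M g')))%N.
Proof.
move=> ker0 theta_g.
set T := tens_supermod M g; set T' := tens_supermod M g'.
pose tau : 'Hom(T, T') := tens_lfun (parity M) theta.
have tau_inj : injective tau.
  apply: (can_inj (g := tens_lfun (parity M) (theta^-1)%VF)) => x.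
  rewrite -comp_lfunE tens_lfun_comp parityK lker0_compVf //.
  by rewrite tens_lfun1 id_lfunE.
have tau_gen i x : tau (sgen T i x) = sgen T' i (tau x).
  rewrite -!comp_lfunE !tens_lfun_comp parity_sgen.
  have -> : (theta \o g i)%VF = - (g' i \o theta)%VF.
    by apply/lfunP => y; rewrite opp_lfunE !comp_lfunE.
  by rewrite tens_lfunNN.
have tau_grade b : (tau @: sgrade T b <= sgrade T' b)%VS.
  apply/subvP => _ /memv_imgP[_ /memv_imgP[x _ ->] ->].
  rewrite /tau -comp_lfunE tens_lfun_comp parity_pi comp_lfun1r -[theta]comp_lfun1l.
  by rewrite -tens_lfun_comp comp_lfunE memv_img ?memvf.
pose post (f : 'Hom(chi, T)) : 'Hom(chi, T') := (tau \o f)%VF.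
have lin_post : linear post.
  by move=> a f h; rewrite /post comp_lfunDr comp_lfunZr.
pose postL : {linear 'Hom(chi, T) -> 'Hom(chi, T')} :=
  HB.pack post (GRing.isLinear.Build F _ _ _ post lin_post).
have postE f : linfun postL f = (tau \o f)%VF by rewrite lfunE.
have ker_post : lker (linfun postL) == 0%VS.
  apply/lker0P => f h; rewrite !postE => /lfunP fh.
  by apply/lfunP => x; apply: tau_inj; have := fh x; rewrite !comp_lfunE.
have sub : (superHom chi T <= linfun postL @^-1: superHom chi T')%VS.
  apply/span_predP => f [c [f_grade f_gen]]; rewrite -memv_preim postE.
  apply: mem_span_pred; exists c; split=> [b|i m].
    by rewrite limg_comp (subv_trans _ (tau_grade _)) // limgS.
  by rewrite !comp_lfunE f_gen linearZ /= tau_gen.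
rewrite -(limg_dim_eq (f := linfun postL)) ?(eqP ker_post) ?capv0 //.
apply/dimvS/subvP => _ /memv_imgP[f /(subvP sub) ? ->].
by rewrite memv_preim.
Qed.

Lemma superHom_tens0 (M chi : supermod F I) (V : vectType F)
    (g : I -> 'End(V)) :
  (forall x : V, x = 0) -> superHom chi (tens_supermod M g) = 0%VS.
Proof.
move=> V0; have dimV : dim V = 0%N.
  by rewrite -dimvf; apply/eqP; rewrite dimv_eq0 -subv0; apply/subvP => x _;
    rewrite [x]V0 mem0v.
apply/eqP; rewrite -subv0; apply/span_predP => f _; rewrite memv0.
apply/eqP/lfunP => x; rewrite zero_lfunE; apply/matrixP => i [j j_lt].
by have := j_lt; rewrite {1}dimV.
Qed.

End ParityTwist.

(** * Palindromicity *)

Theorem theorem3p12 (R : realType) (n : nat) (W : weyl_group R n.+1)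
    (U : supermod R[i] 'rV[R[i]]_n.+1) (chi : supermod R[i] 'I_n.+1) :
  irreducible_root_system (wgram W) (wroots W) ->
  clifford_module W U -> simple_supermod U ->
  spin_module W chi -> simple_supermod chi ->
  exists P : {poly R[i]},
    is_spin_fake_degree W U chi P /\
    forall t : R[i], t != 0 -> P.[t] = t ^+ #|reflections W| * P.[t^-1].
Proof.
move=> _ _ _ _ _; set N := #|_|; pose c := spin_fake_coef W U chi.
have c_le d e : (d + e)%N = N -> (c d <= c e)%N.
  move=> /coinvariants_duality[theta [ker0 theta_act]].
  exact: (superHom_parity_twist (basic_spin W U) chi ker0 theta_act).
have c_sym d e : (d + e)%N = N -> c d = c e.
  by move=> de; apply/eqP; rewrite eqn_leq !c_le // addnC.
exists (\poly_(k < N.+1) (c k)%:R); split=> [k|t t0].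
  rewrite coef_poly ltnS; case: leqP => [_|Nk]; first by [].
  have := superHom_tens0 (basic_spin W U) chi (coinvariant_act W k)
    (coinvariants_high_degree Nk).
  by rewrite /c /spin_fake_coef => ->; rewrite dimv0.
rewrite !horner_poly mulr_sumr (reindex_inj rev_ord_inj) /=.
apply: eq_bigr => k _; rewrite subSS mulrCA.
have kN : (k <= N)%N by rewrite -ltnS.
rewrite (c_sym (N - k)%N k) ?subnK //; congr (_ * _).
by rewrite exprVn expfB_cond ?(negPf t0).
Qed.
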